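(* For every PNTS $(S,\rightarrow)$, every $\mathbf{PCTL}$-interpretation $\rho$ of the propositional letters (viewed as $\{0,1\}$-valued functions on $S$, and as a Łukasiewicz $\mu$-calculus interpretation with $\rho(\overline P)=1-\rho(P)$), and every $\mathbf{PCTL}$ state formula $\phi$, we have $\llbracket\phi\rrbracket^{\mathbf{PCTL}}_\rho(s)=\llbracket\mathbf{E}(\phi)\rrbracket_\rho(s)$ for all $s\in S$.
   Context: PNTS: $(S,\rightarrow)$ with $\rightarrow\subseteq S\times\mathcal{D}(S)$, $\mathcal{D}(S)$ the discrete probability distributions on $S$. Let $s\leadsto t$ iff $s\rightarrow d$ and $d(t)>0$ for some $d$. Łukasiewicz $\mu$-calculus: formulas $\phi::= X\mid P\mid \overline{P}\mid q\,\phi\mid \phi\sqcup\phi\mid\phi\sqcap\phi\mid\phi\oplus\phi\mid\phi\odot\phi\mid\Diamond\phi\mid\Box\phi\mid\mu X.\phi\mid\nu X.\phi$ ($q$ rational in $[0,1]$). Semantics $\llbracket\phi\rrbracket_\rho:S\to[0,1]$ under interpretation $\rho$ (functions $S\to[0,1]$ for variables and letters, $\rho(\overline P)=1-\rho(P)$): variables/letters by $\rho$; $q\phi$ multiplies by $q$; $\sqcup,\sqcap$ are pointwise max/min; $\oplus$ is $\min\{1,a+b\}$, $\odot$ is $\max\{0,a+b-1\}$; $\llbracket\Diamond\phi\rrbracket_\rho(x)=\sup_{x\rightarrow d}\sum_y d(y)\llbracket\phi\rrbracket_\rho(y)$, $\llbracket\Box\phi\rrbracket_\rho(x)=\inf_{x\rightarrow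 d}\sum_y d(y)\llbracket\phi\rrbracket_\rho(y)$ ($\sup\emptyset=0$, $\inf\emptyset=1$); $\mu,\nu$ are least/greatest fixed points of $f\mapsto\llbracket\phi\rrbracket_{\rho[f/X]}$. $\underline{1}=\nu X.X$, $\underline q=q\,\underline 1$. For closed $\phi$, $\mathrm{dual}(\phi)$ replaces each of $\sqcup,\sqcap,\oplus,\odot,\Diamond,\Box,\mu,\nu, P,\overline P$ by its dual ($\sqcap,\sqcup,\odot,\oplus,\Box,\Diamond,\nu,\mu,\overline P,P$) and $q\,\psi$ by $(1-q)\,\psi$. Threshold modalities: $\mathbb{P}_{>0}\phi=\mu X.(X\oplus\phi)$, $\mathbb{P}_{=1}\phi=\nu X.(X\odot\phi)$, $\mathbb{P}_{>q}\phi=\mathbb{P}_{>0}(\phi\odot\underline{1-q})$, $\mathbb{P}_{\geq q}\phi=\mathbb{P}_{=1}(\phi\oplus\underline{1-q})$ for $q\in\mathbb{Q}\cap(0,1)$. $\boxdot\phi:=\Box\phi\sqcap\Diamond\underline 1$. PCTL: state formulas $\phi::=\mathrm{true}\mid P\mid\neg\phi\mid\phi\vee\phi\mid\exists\psi\mid\forall\psi\mid\mathbb{P}^\exists_{\rtimes q}\psi\mid\mathbb{P}^\forall_{\rtimes q}\psi$ with $q\in\mathbb{Q}\cap[0,1]$, $\rtimes\in\{>,\geq\}$; path formulas $\psi::=\circ\phi\mid\phi_1\mathcal U\phi_2$. A path is a finite or infinite sequence $s_0s_1\dots$ with $s_i\leadsto s_{i+1}$; it is maximal if infinite or its last state has no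 $\leadsto$-successor. $\mathrm{P}(\mathcal L)$ is the set of maximal paths with topology generated by the cylinders $U_{\vec s}$ (maximal paths extending the finite sequence $\vec s$); $\mathrm{P}(s)=U_{s}$. A scheduler $\sigma$ is a partial map from nonempty finite state sequences $s_0\dots s_n$ to distributions, defined iff $s_n$ has some transition, with $s_n\rightarrow\sigma(s_0\dots s_n)$. For $s\in S$ and scheduler $\sigma$, $m^s_\sigma$ is the unique Borel probability measure on $\mathrm{P}(\mathcal L)$ with $m^s_\sigma(U_{s_0\dots s_n})=\prod_{i=0}^{n-1}d_i(s_{i+1})$ if $s_0=s$ (and $0$ otherwise), where $d_i=\sigma(s_0\dots s_i)$ and the empty product is $1$. A PCTL-interpretation is $\rho:\mathrm{Prop}\to 2^S$. Semantics $\llbracket\cdot\rrbracket^{\mathbf{PCTL}}_\rho$ (subsets of $S$, identified with $\{0,1\}$-valued functions): $\mathrm{true}\mapsto S$, $P\mapsto\rho(P)$, $\vee$ union, $\neg$ complement; $s\in\llbracket\exists\psi\rrbracket$ iff some $\vec s\in\mathrm P(s)$ lies in $\llbracket\psi\rrbracket$; $s\in\llbracket\forall\psi\rrbracket$ iff all $\vec s\in\mathrm P(s)$ lie in $\llbracket\psi\rrbracket$; $s\in\llbracket\mathbb{P}^\exists_{\rtimes q}\psi\rrbracket$ iff $(\sup_\sigma m^s_\sigma(\llbracket\psi\rrbracket))\rtimes q$; $s\in\llbracket\mathbb{P}^\forall_{\rtimes q}\psi\rrbracket$ iff $(\inf_\sigma m^s_\sigma(\llbracket\psi\rrbracket))\rtimes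 q$. Path semantics: $\vec s\in\llbracket\circ\phi\rrbracket$ iff $\vec s$ has length $\ge 2$ and $s_1\in\llbracket\phi\rrbracket$; $\vec s\in\llbracket\phi_1\mathcal U\phi_2\rrbracket$ iff $\exists n$ ($s_n\in\llbracket\phi_2\rrbracket$ and $s_m\in\llbracket\phi_1\rrbracket$ for all $m<n$). The encoding $\mathbf E$ into closed Łukasiewicz $\mu$-calculus formulas: $\mathbf E(P)=P$; $\mathbf E(\mathrm{true})=\underline 1$; $\mathbf E(\phi_1\vee\phi_2)=\mathbf E(\phi_1)\sqcup\mathbf E(\phi_2)$; $\mathbf E(\neg\phi)=\mathrm{dual}(\mathbf E(\phi))$; $\mathbf E(\exists\circ\phi)=\mathbb P_{>0}(\Diamond\mathbf E(\phi))$; $\mathbf E(\forall\circ\phi)=\mathbb P_{=1}(\boxdot\mathbf E(\phi))$; $\mathbf E(\exists(\phi_1\mathcal U\phi_2))=\mu X.(\mathbf E(\phi_2)\sqcup(\mathbf E(\phi_1)\sqcap\mathbb P_{>0}(\Diamond X)))$; $\mathbf E(\forall(\phi_1\mathcal U\phi_2))=\mu X.(\mathbf E(\phi_2)\sqcup(\mathbf E(\phi_1)\sqcap\mathbb P_{=1}(\boxdot X)))$; $\mathbf E(\mathbb P^\exists_{\rtimes q}\circ\phi)=\mathbb P_{\rtimes q}(\Diamond\mathbf E(\phi))$; $\mathbf E(\mathbb P^\forall_{\rtimes q}\circ\phi)=\mathbb P_{\rtimes q}(\boxdot\mathbf E(\phi))$; $\mathbf E(\mathbb P^\exists_{\rtimes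 q}(\phi_1\mathcal U\phi_2))=\mathbb P_{\rtimes q}(\mu X.(\mathbf E(\phi_2)\sqcup(\mathbf E(\phi_1)\sqcap\Diamond X)))$; $\mathbf E(\mathbb P^\forall_{\rtimes q}(\phi_1\mathcal U\phi_2))=\mathbb P_{\rtimes q}(\mu X.(\mathbf E(\phi_2)\sqcup(\mathbf E(\phi_1)\sqcap\boxdot X)))$. Here $\mathbb P_{\rtimes q}$ denotes the threshold modality $\mathbb P_{>q}$ or $\mathbb P_{\geq q}$ (read as $\mathbb P_{>0}$ for $>0$, and $\mathbb P_{=1}$ for $\geq 1$; $\geq 0$ is trivially true and $>1$ trivially false). *)

(* Defs.v *)
From HB Require Import structures.
From mathcomp Require Import all_boot all_order all_algebra.
From mathcomp Require Import interval_inference.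
From mathcomp Require Import all_classical all_reals all_analysis.

Set Implicit Arguments.
Unset Strict Implicit.
Unset Printing Implicit Defensive.

Import Order.TTheory GRing.Theory Num.Theory.
Import numFieldNormedType.Exports.

Local Open Scope classical_set_scope.
Local Open Scope ring_scope.

(* A PNTS (probabilistic nondeterministic transition system) on S is a map
   [step : S -> set (distr R S)], with [step x d] for x -> d. *)

Record distr (R : realType) (S : choiceType) := Distr {
  distr_fun :> S -> R;
  distr_ge0 : forall y, 0 <= distr_fun y;
  distr_sum1 : (\esum_(y in [set: S]) (distr_fun y)%:E = 1)%E }.

Definition leads (R : realType) (S : choiceType) (step : S -> set (distr R S))
    (x y : S) : Prop :=
  exists2 d, step x d & 0 < d y.

(* Formulas of the Lukasiewicz mu-calculus: propositional letters range over A,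
   fixed point variables are named by natural numbers. *)
Inductive lmu (A : Type) : Type :=
| Var of nat
| Lit of A
| NLit of A
| Scal of {i01 rat} & lmu A
| Max of lmu A & lmu A
| Min of lmu A & lmu A
| Oplus of lmu A & lmu A
| Odot of lmu A & lmu A
| Dia of lmu A
| Box of lmu A
| Mu of nat & lmu A
| Nu of nat & lmu A.

Arguments Var {A}.

(* A variable above every variable, free or bound, of the formula. *)
Fixpoint fresh (A : Type) (f : lmu A) : nat :=
  match f with
  | Var X => X.+1
  | Lit _ | NLit _ => 0%N
  | Scal _ g | Dia g | Box g => fresh g
  | Max g h | Min g h | Oplus g h | Odot g h => maxn (fresh g) (fresh h)
  | Mu X g | Nu X g => maxn X.+1 (fresh g)
  end.

Section LmuSemantics.
Context (R : realType) (S : choiceType) (step : S -> set (distr R S)).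
Context (A : Type).

Definition unit_valued (f : S -> R) : Prop := forall x, 0 <= f x <= 1.

Definition is_lfp (F : (S -> R) -> (S -> R)) (f : S -> R) : Prop :=
  [/\ unit_valued f, F f = f &
      forall g, unit_valued g -> F g = g -> forall x, f x <= g x].

Definition is_gfp (F : (S -> R) -> (S -> R)) (f : S -> R) : Prop :=
  [/\ unit_valued f, F f = f &
      forall g, unit_valued g -> F g = g -> forall x, g x <= f x].

(* Such an f is unique when it exists; the default value is only used when it
   does not. *)
Definition lfp (F : (S -> R) -> (S -> R)) : S -> R := xget (fun=> 0) (is_lfp F).
Definition gfp (F : (S -> R) -> (S -> R)) : S -> R := xget (fun=> 1) (is_gfp F).

Definition expect (d : distr R S) (f : S -> R) : R :=
  fine (\esum_(y in [set: S]) (d y * f y)%:E).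

Definition dia_sem (f : S -> R) (x : S) : R :=
  if `[< step x !=set0 >] then sup [set expect d f | d in step x] else 0.

Definition box_sem (f : S -> R) (x : S) : R :=
  if `[< step x !=set0 >] then inf [set expect d f | d in step x] else 1.

Fixpoint lmu_sem (rho : A -> S -> R) (v : nat -> S -> R) (f : lmu A)
    {struct f} : S -> R :=
  match f with
  | Var X => v X
  | Lit P => rho P
  | NLit P => fun x => 1 - rho P x
  | Scal q g => fun x => ratr q%:num * lmu_sem rho v g x
  | Max g h => fun x => Num.max (lmu_sem rho v g x) (lmu_sem rho v h x)
  | Min g h => fun x => Num.min (lmu_sem rho v g x) (lmu_sem rho v h x)
  | Oplus g h => fun x => Num.min 1 (lmu_sem rho v g x + lmu_sem rho v h x)
  | Odot g h => fun x => Num.max 0 (lmu_sem rho v g x + lmu_sem rho v h x - 1)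
  | Dia g => dia_sem (lmu_sem rho v g)
  | Box g => box_sem (lmu_sem rho v g)
  | Mu X g => lfp (fun h => lmu_sem rho [eta v with X |-> h] g)
  | Nu X g => gfp (fun h => lmu_sem rho [eta v with X |-> h] g)
  end.

End LmuSemantics.

Section LmuDerived.
Context (A : Type).
Implicit Types (f g : lmu A) (q : {i01 rat}).

(* In the scalar case the multiplied formula is itself left unchanged:
   dual (q f) = (1 - q) f. Hence the dual of the constant q 1 is (1 - q) 1;
   dualizing under the scalar would yield (1 - q) 0 = 0 instead. *)
Fixpoint dual f : lmu A :=
  match f with
  | Var X => Var X
  | Lit P => NLit P
  | NLit P => Lit P
  | Scal q g => Scal (1 - q%:num)%:i01 g
  | Max g h => Min (dual g) (dual h)
  | Min g h => Max (dual g) (dual h)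
  | Oplus g h => Odot (dual g) (dual h)
  | Odot g h => Oplus (dual g) (dual h)
  | Dia g => Box (dual g)
  | Box g => Dia (dual g)
  | Mu X g => Nu X (dual g)
  | Nu X g => Mu X (dual g)
  end.

Definition one_f : lmu A := Nu 0 (Var 0).
Definition const_f q : lmu A := Scal q one_f.

Definition prob_gt0 f : lmu A := let X := fresh f in Mu X (Oplus (Var X) f).
Definition prob_eq1 f : lmu A := let X := fresh f in Nu X (Odot (Var X) f).

Definition prob_gt q f : lmu A :=
  if q%:num == 0 then prob_gt0 f
  else if q%:num == 1 then const_f 0%:i01
  else prob_gt0 (Odot f (const_f (1 - q%:num)%:i01)).

Definition prob_ge q f : lmu A :=
  if q%:num == 1 then prob_eq1 f
  else if q%:num == 0 then one_f
  else prob_eq1 (Oplus f (const_f (1 - q%:num)%:i01)).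

Definition boxdot f : lmu A := Min (Box f) (Dia one_f).

End LmuDerived.

Inductive cmp := Gt | Ge.

Inductive pctl (A : Type) : Type :=
| PTrue
| PLit of A
| PNot of pctl A
| POr of pctl A & pctl A
| PEx of pctl_path A
| PAll of pctl_path A
| PProbEx of cmp & {i01 rat} & pctl_path A
| PProbAll of cmp & {i01 rat} & pctl_path A
with pctl_path (A : Type) : Type :=
| Next of pctl A
| Until of pctl A & pctl A.

Section Paths.
Context (R : realType) (S : choiceType) (step : S -> set (distr R S)).

(* A nonempty finite or infinite sequence is coded by p : nat -> option S, with
   p n = None exactly for the positions n past the end of the sequence. *)
Definition is_mpath (p : nat -> option S) : Prop :=
  p 0%N <> None /\
  forall n, match p n, p n.+1 with
    | Some x, Some y => leads step x y
    | Some x, None => forall y, ~ leads step x y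
    | None, Some _ => False
    | None, None => True
    end.

Record mpath := MPath { mpath_fun :> nat -> option S; _ : is_mpath mpath_fun }.

HB.instance Definition _ := gen_eqMixin mpath.
HB.instance Definition _ := gen_choiceMixin mpath.

Definition cylinder (w : seq S) : set mpath :=
  [set p | forall i, (i < size w)%N -> p i = onth w i].

HB.instance Definition _ := isSubBaseTopological.Build mpath (range cylinder) id.

Fact exists_mpath (s : S) : exists p : mpath, p 0%N = Some s.
Proof.
pose nxt (o : option S) : option S :=
  if o is Some x then
    if pselect (exists y, leads step x y) is left e then Some (projT1 (cid e))
    else None
  else None.
have pP : is_mpath (fun n => iter n nxt (Some s)).
  split=> // n; rewrite iterS.
  case: (iter n nxt (Some s)) => [x|//] /=.
  case: pselect => [e|ne]; first exact: projT2 (cid e).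
  by move=> y xy; apply: ne; exists y.
by exists (MPath pP).
Qed.

(* Measurable types must be pointed, and there is no maximal path when S is
   empty; [mpath_at s] is the space of all maximal paths, whatever s: the state
   only serves to provide a point. *)
Definition mpath_at (s : S) : Type := mpath.

HB.instance Definition _ (s : S) := Topological.on (mpath_at s).
HB.instance Definition _ (s : S) :=
  isPointed.Build (mpath_at s) (projT1 (cid (exists_mpath s))).

Definition borel_mpath (s : S) := g_sigma_algebraType (@open (mpath_at s)).

Definition is_scheduler (sigma : seq S -> option (distr R S)) : Prop :=
  forall h x, match sigma (rcons h x) with
    | Some d => step x d
    | None => step x = set0
    end.

(* The probability m^s_sigma (U_(x :: h)). If some sigma (s_0 ... s_i) with
   i < n is undefined then U_(s_0 ... s_n) is empty and the product is 0. *)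
Definition cylinder_prob (s : S) (sigma : seq S -> option (distr R S))
    (x : S) (h : seq S) : R :=
  if x == s then
    \prod_(i < size h) (if sigma (take i.+1 (x :: h)) is Some d
                        then d (nth x h i) else 0)
  else 0.

(* The unique Borel probability measure with the prescribed values on
   cylinders (the default value is only used if there is none). *)
Definition path_measure (s : S) (sigma : seq S -> option (distr R S)) :
    set mpath -> \bar R :=
  xget (fun=> 0%E)
    [set m : set mpath -> \bar R |
      exists2 mu : probability (borel_mpath s) R, m = (mu : set mpath -> \bar R) &
      forall x h, mu (cylinder (x :: h)) = (cylinder_prob s sigma x h)%:E].

End Paths.

Section PCTLSemantics.
Context (R : realType) (S : choiceType) (step : S -> set (distr R S)).
Context (A : Type) (rho : A -> set S).

Definition compares (c : cmp) (a : \bar R) (q : {i01 rat}) : Prop :=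
  match c with
  | Gt => ((ratr q%:num)%:E < a)%E
  | Ge => ((ratr q%:num)%:E <= a)%E
  end.

Fixpoint pctl_sem (phi : pctl A) : set S :=
  match phi with
  | PTrue => setT
  | PLit P => rho P
  | PNot phi1 => ~` pctl_sem phi1
  | POr phi1 phi2 => pctl_sem phi1 `|` pctl_sem phi2
  | PEx psi =>
      [set s | exists p : mpath step, cylinder [:: s] p /\ path_sem psi p]
  | PAll psi =>
      [set s | forall p : mpath step, cylinder [:: s] p -> path_sem psi p]
  | PProbEx c q psi =>
      [set s | compares c (ereal_sup [set path_measure s sigma (path_sem psi)
                                     | sigma in is_scheduler step]) q]
  | PProbAll c q psi =>
      [set s | compares c (ereal_inf [set path_measure s sigma (path_sem psi)
                                     | sigma in is_scheduler step]) q]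
  end
with path_sem (psi : pctl_path A) : set (mpath step) :=
  match psi with
  | Next phi => [set p | exists2 y, p 1%N = Some y & pctl_sem phi y]
  | Until phi1 phi2 =>
      [set p | exists n,
        (exists2 y, p n = Some y & pctl_sem phi2 y) /\
        (forall m, (m < n)%N -> exists2 y, p m = Some y & pctl_sem phi1 y)]
  end.

End PCTLSemantics.

Definition prob_cmp (A : Type) (c : cmp) : {i01 rat} -> lmu A -> lmu A :=
  match c with Gt => @prob_gt A | Ge => @prob_ge A end.

Definition until_f (A : Type) (nxt : lmu A -> lmu A) (f1 f2 : lmu A) : lmu A :=
  let X := maxn (fresh f1) (fresh f2) in Mu X (Max f2 (Min f1 (nxt (Var X)))).

Fixpoint encode (A : Type) (phi : pctl A) : lmu A :=
  match phi with
  | PTrue => one_f A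
  | PLit P => Lit P
  | PNot phi1 => dual (encode phi1)
  | POr phi1 phi2 => Max (encode phi1) (encode phi2)
  | PEx (Next phi1) => prob_gt0 (Dia (encode phi1))
  | PEx (Until phi1 phi2) =>
      until_f (fun f => prob_gt0 (Dia f)) (encode phi1) (encode phi2)
  | PAll (Next phi1) => prob_eq1 (boxdot (encode phi1))
  | PAll (Until phi1 phi2) =>
      until_f (fun f => prob_eq1 (boxdot f)) (encode phi1) (encode phi2)
  | PProbEx c q (Next phi1) => prob_cmp c q (Dia (encode phi1))
  | PProbEx c q (Until phi1 phi2) =>
      prob_cmp c q (until_f (@Dia A) (encode phi1) (encode phi2))
  | PProbAll c q (Next phi1) => prob_cmp c q (boxdot (encode phi1))
  | PProbAll c q (Until phi1 phi2) =>
      prob_cmp c q (until_f (@boxdot A) (encode phi1) (encode phi2))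
  end.

(* Main.v *)
(* The fixed points of the probabilistic until operators are matched with
   optimal hitting probabilities. For a fixed scheduler, the probability of an
   until property from a history is the increasing limit of the probabilities of
   hitting within n steps, which are computed by iterated expectations. The
   supremum (infimum) over schedulers of this limit is the least prefixed point of
   the corresponding operator: it is a prefixed point because schedulers can be
   composed with (shifted by) a first step; it lies below any other one, for the
   supremum by induction on n, for the infimum because of the scheduler that
   makes an e/2^(n+1)-optimal choice at its n-th step.
   A path measure exists since a uniform random number u in [0, 1[ drives a path:
   u selects the first successor by comparison with the distribution function of
   the scheduled distribution, and its rescaled position within the selected
   interval drives the rest of the path. *)

Require Import Defs.
From HB Require Import structures.
From mathcomp Require Import all_boot all_order all_algebra.
From mathcomp Require Import all_classical all_reals all_analysis.
From mathcomp Require Import ring lra.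

Set Implicit Arguments.
Unset Strict Implicit.
Unset Printing Implicit Defensive.

Import Order.TTheory GRing.Theory Num.Theory.
Import numFieldNormedType.Exports.

Local Open Scope classical_set_scope.
Local Open Scope ring_scope.

(** * Cylinders and the topology of paths *)

(** [S] may be uncountable. Unions of cylinders are then uncountable and sums over [S] unordered, so
    path events are shown measurable by being open, and additivity over successors comes from the
    total mass of a distribution. At a dead state the empty infimum of [Box] is 1, while no path
    takes a step from there; [boxdot] corrects this value to 0. An infimum over transitions need not
    be attained, and a constant error per step would accumulate without bound: the tolerance must
    shrink along the history, so a near-optimal scheduler has to know how many steps were made.
    Negation is delicate because 1 - q f differs from (1 - q) f, so [dual] is not complementation on
    all formulas; the induction on PCTL formulas carries the invariant [scal_const], that scalars
    only multiply the constant 1. *)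

Lemma onth_rcons (T : Type) (w : seq T) y i :
  onth (rcons w y) i = if i == size w then Some y else onth w i.
Proof.
rewrite -cats1 onth_cat; case: ltngtP => [//|wi|->]; last by rewrite subnn.
by rewrite !onth_default//= ?subn_gt0// ltnW.
Qed.

Section Cylinders.
Context (R : realType) (S : choiceType) (step : S -> set (distr R S)) (s : S).

Lemma cylinder_le (w w' : seq S) (p : mpath step) :
  cylinder w p -> cylinder w' p -> (size w <= size w')%N ->
  cylinder w' `<=` @cylinder _ _ step w.
Proof.
move=> wp w'p le q w'q i iw; rewrite -(wp i iw).
have iw' := leq_trans iw le.
by rewrite (w'p i iw') (w'q i iw').
Qed.

(** Cylinders through a common path are nested, so the longest word of the list works; the empty
    word serves the empty list. *)
Lemma cylinder_bigcap (L : seq (set (mpath step))) (p : mpath step) :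
  (forall C, C \in L -> range (@cylinder _ _ step) C /\ C p) ->
  exists2 w, cylinder w p & forall C, C \in L -> cylinder w `<=` C.
Proof.
elim: L => [_|C L IH H]; first by exists [::].
have [w wp wL] : exists2 w, cylinder w p & forall C, C \in L -> cylinder w `<=` C.
  by apply: IH => C' C'L; apply: H; rewrite in_cons C'L orbT.
have [[w' _ Cw'] Cp] := H C (mem_head _ _); rewrite -Cw' in Cp.
have [le|/ltnW le] := leqP (size w) (size w').
  exists w' => // C'; rewrite in_cons => /orP[/eqP->|/wL]; first by rewrite -Cw'.
  by apply: subset_trans; exact: cylinder_le wp Cp le.
exists w => // C'; rewrite in_cons => /orP[/eqP->|/wL//].
by rewrite -Cw'; exact: cylinder_le Cp wp le.
Qed.

(** By [cylinder_bigcap], finite intersections of cylinders add no new neighbourhoods: cylinders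
    form a base, not only a subbase. *)
Lemma open_mpathP (B : set (mpath_at step s)) :
  open B <-> forall p, B p -> exists2 w, cylinder w p & cylinder w `<=` B.
Proof.
split=> [[D0 D0s <-] p [C D0C Cp]|HB].
  have [F Fb EC] := D0s _ D0C.
  have /cylinder_bigcap[w wp wF] : forall C', C' \in finmap.enum_fset F ->
      range (@cylinder _ _ step) C' /\ C' p.
    move=> C' C'F; split; last by move: Cp; rewrite -EC; apply.
    by have := Fb _ C'F; rewrite inE.
  exists w => // q wq; exists C => //; rewrite -EC.
  by suff: (forall C' : set (mpath step), C' \in finmap.enum_fset F -> C' q)
    by []; move=> C' C'F; exact: wF wq.
exists [set C | range (@cylinder _ _ step) C /\ C `<=` B].
  move=> C [[w _ <-] _]; exists (finmap.fset1 (cylinder w : set (mpath step))).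
    by move=> C'; rewrite finmap.inE => /eqP->; rewrite inE; exists w.
  rewrite predeqE => q; split=> [/(_ (cylinder w : set (mpath step)))|].
    by apply; rewrite /= finmap.inE.
  by move=> wq C'; rewrite /= finmap.inE => /eqP->.
rewrite predeqE => p; split=> [[C [_ CB] /CB//]|/HB[w wp wB]].
by exists (cylinder w) => //; split=> //; exists w.
Qed.


Lemma cylinder_rcons (w : seq S) y (p : mpath step) :
  cylinder (rcons w y) p <-> cylinder w p /\ p (size w) = Some y.
Proof.
split=> [wp|[wp py] i].
  split; last by rewrite (wp (size w)) ?size_rcons// onth_rcons eqxx.
  move=> i iw; rewrite (wp i) ?size_rcons ?ltnS 1?ltnW//.
  by rewrite onth_rcons ltn_eqF.
rewrite size_rcons ltnS onth_rcons; case: eqP => [->//|/eqP ne le].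
by apply: wp; rewrite ltn_neqAle ne.
Qed.

Lemma mpathP (p : mpath step) : is_mpath step p.
Proof. by case: p. Qed.

Lemma mpath_none (p : mpath step) n m : p n = None -> (n <= m)%N -> p m = None.
Proof.
move=> pn /subnKC <-; elim: (m - n)%N => [|k IH]; first by rewrite addn0.
rewrite addnS; have [_ /(_ (n + k)%N)] := mpathP p.
by rewrite IH; case: (p _).
Qed.

Lemma mpath_leads (p : mpath step) n x y :
  p n = Some x -> p n.+1 = Some y -> leads step x y.
Proof.
have [_ /(_ n)] := mpathP p.
by move=> + pn pn1; rewrite pn pn1.
Qed.

Lemma mpath_end (p : mpath step) n x :
  p n = Some x -> p n.+1 = None -> forall y, ~ leads step x y.
Proof.
have [_ /(_ n)] := mpathP p.
by move=> + pn pn1; rewrite pn pn1.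
Qed.

Lemma mpath0 (p : mpath step) : exists x, p 0%N = Some x.
Proof.
have [+ _] := mpathP p.
by case: (p 0%N) => // x; exists x.
Qed.

(** No word records that a path has ended. However, a path that ends is determined by its word: its
    last state has no successor, so no other maximal path extends that word, and all later positions
    are fixed as well. *)
Lemma cylinder_prefix (p : mpath step) n :
  exists2 w, cylinder w p &
    forall q : mpath step, cylinder w q -> forall i, (i <= n)%N -> q i = p i.
Proof.
suff [[w [sw wp]]|[w wp wq]] : (exists w, size w = n.+1 /\ cylinder w p) \/
    exists2 w, cylinder w p & forall q : mpath step, cylinder w q -> q =1 p.
- by exists w => // q wq i ni; rewrite (wp i) ?(wq i)// sw.
- by exists w => // q /wq.
elim: n => [|n [[w [sw wp]]|]]; last by right.
  have [x px] := mpath0 p; left; exists [:: x]; split=> // i.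
  by rewrite ltnS leqn0 => /eqP->.
case pn: (p n.+1) => [y|].
  left; exists (rcons w y); rewrite size_rcons sw; split=> //.
  by apply/cylinder_rcons; rewrite sw.
right; exists w => // q wq i.
have [iw|wi] := ltnP i (size w); first by rewrite wp// wq.
move: wp wq sw wi => /=; case/lastP: w => // w x /cylinder_rcons[wp px].
move=> /cylinder_rcons[_ qx]; rewrite size_rcons => -[sw] ni.
rewrite sw in px qx ni; rewrite (mpath_none pn ni).
case qn: (q n.+1) => [y|]; last exact: mpath_none qn ni.
by have := mpath_end px pn (mpath_leads qx qn).
Qed.

Lemma measurable_open_mpath (B : set (borel_mpath step s)) :
  open (B : set (mpath_at step s)) -> measurable B.
Proof. by move=> oB; apply: sub_sigma_algebra. Qed.

(** Around each of its paths such an event contains a whole cylinder, so it is open, hence Borel,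
    even as an uncountable union. *)
Lemma measurable_prefix (B : set (borel_mpath step s)) n :
  (forall p q : mpath step, (forall i, (i <= n)%N -> q i = p i) -> B p -> B q) ->
  measurable B.
Proof.
move=> HB; apply: measurable_open_mpath; apply/open_mpathP => p Bp.
have [w wp wq] := cylinder_prefix p n.
by exists w => // q /wq qp; exact: HB Bp.
Qed.
End Cylinders.

(** * Expectation and the modalities *)

Lemma esumZl (R : realType) (T : choiceType) (I : set T) (c : R)
    (a : T -> \bar R) : 0 <= c -> (forall i, (0 <= a i)%E) ->
  \esum_(i in I) (c%:E * a i)%E = (c%:E * \esum_(i in I) a i)%E.
Proof.
have ub (k : R) (b : T -> \bar R) : 0 <= k -> (forall i, (0 <= b i)%E) ->
    (\esum_(i in I) (k%:E * b i) <= k%:E * \esum_(i in I) b i)%E.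
  move=> k0 b0; apply: ge_ereal_sup => _ [F [finF FI] <-].
  rewrite -ge0_mule_fsumr//.
  rewrite lee_wpmul2l ?lee_fin//; apply: esum_ge; by exists F.
move=> c0 a0; apply/eqP; rewrite eq_le ub//=.
have [->|cn0] := eqVneq c 0.
  by rewrite mul0e; apply: esum_ge0 => i _; rewrite mul0e.
have cp : 0 < c by rewrite lt_neqAle eq_sym cn0.
(* The converse inequality is [ub] for the constant c^-1. *)
rewrite -lee_pdivlMl//; apply: le_trans (ub _ _ _ _).
- by apply: le_esum => i Ii; rewrite muleA -EFinM mulVf// mul1e.
- by rewrite invr_ge0.
- by move=> i; rewrite mule_ge0.
Qed.

Section Expectation.
Context (R : realType) (S : choiceType).
Implicit Types (d : distr R S) (f g : S -> R).

Lemma expectE d f : unit_valued f ->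
  (expect d f)%:E = \esum_(y in [set: S]) (d y * f y)%:E.
Proof.
move=> fu; rewrite /expect fineK// ge0_fin_numE; last first.
  by apply: esum_ge0 => y _; rewrite lee_fin mulr_ge0 ?distr_ge0//; case/andP: (fu y).
apply: (@le_lt_trans _ _ 1%E); last by rewrite ltry.
rewrite -(distr_sum1 d); apply: le_esum => y _.
by rewrite lee_fin ler_piMr ?distr_ge0//; case/andP: (fu y).
Qed.

Lemma unit_compl f : unit_valued f -> unit_valued (fun x => 1 - f x).
Proof. by move=> fu x; have /andP[? ?] := fu x; apply/andP; lra. Qed.

Lemma unit_cst1 : unit_valued ((fun=> 1) : S -> R).
Proof. by move=> x; rewrite ler01 lexx. Qed.

Lemma unit_cst0 : unit_valued ((fun=> 0) : S -> R).
Proof. by move=> x; rewrite ler01 lexx. Qed.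

Lemma unit_indic (B : set S) : unit_valued (\1_B : S -> R).
Proof. by move=> x; rewrite indicE; case: (_ \in _); rewrite ?lexx ler01. Qed.

Lemma expect_cst1 d : expect d (fun=> 1) = 1.
Proof.
apply: EFin_inj; rewrite expectE; last exact: unit_cst1.
by rewrite -(distr_sum1 d); apply: eq_esum => y _; rewrite mulr1.
Qed.

Lemma expect_le_add d f g (c : R) : unit_valued f -> unit_valued g -> 0 <= c ->
  (forall x, f x <= g x + c) -> expect d f <= expect d g + c.
Proof.
move=> fu gu c0 fg; rewrite -lee_fin EFinD !expectE//.
have -> : c%:E = \esum_(y in [set: S]) (d y * c)%:E.
  rewrite (eq_esum (b := fun y => (c%:E * (d y)%:E)%E)); last first.
    by move=> y _; rewrite mulrC.
  by rewrite esumZl ?distr_sum1 ?mule1// => y; rewrite lee_fin distr_ge0.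
rewrite -esumD => [|y _|y _]; rewrite ?lee_fin ?mulr_ge0 ?distr_ge0//.
- apply: le_esum => y _; rewrite -EFinD lee_fin -mulrDr.
  exact: ler_wpM2l (distr_ge0 d y) _ _ (fg y).
- by case/andP: (gu y).
Qed.

Lemma expect_le d f g : unit_valued f -> unit_valued g ->
  (forall x, f x <= g x) -> expect d f <= expect d g.
Proof.
move=> fu gu fg; rewrite -[leRHS]addr0; apply: expect_le_add => // x.
by rewrite addr0.
Qed.

Lemma expect_compl d f : unit_valued f ->
  expect d (fun x => 1 - f x) = 1 - expect d f.
Proof.
move=> fu; have fu' := unit_compl fu.
apply/eqP; rewrite -(inj_eq (addIr (expect d f))) subrK -eqe; apply/eqP.
rewrite EFinD !expectE// -esumD => [|y _|y _].
- rewrite -(distr_sum1 d); apply: eq_esum => y _.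
  by rewrite -EFinD -mulrDr subrK mulr1.
- by rewrite lee_fin mulr_ge0 ?distr_ge0//; case/andP: (fu' y).
- by rewrite lee_fin mulr_ge0 ?distr_ge0//; case/andP: (fu y).
Qed.

Lemma expect_ge0 d f : unit_valued f -> 0 <= expect d f.
Proof.
move=> fu; rewrite -lee_fin expectE//; apply: esum_ge0 => y _.
by rewrite lee_fin mulr_ge0 ?distr_ge0//; case/andP: (fu y).
Qed.

Lemma expect_le1 d f : unit_valued f -> expect d f <= 1.
Proof.
by move=> fu; rewrite -subr_ge0 -expect_compl// expect_ge0//; exact: unit_compl.
Qed.

Lemma expect_gt0P d f : unit_valued f ->
  0 < expect d f <-> exists2 y, 0 < d y & 0 < f y.
Proof.
move=> fu; split=> [|[y dy fy]].
  apply: contraPP => H; apply/negP; rewrite -leNgt -lee_fin expectE//.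
  rewrite esum1// => y _; congr EFin.
  have /andP[f0 _] := fu y; move: f0 (distr_ge0 d y); rewrite !le_eqVlt.
  case/orP=> [/eqP<-|f0]; first by rewrite mulr0.
  case/orP=> [/eqP<-|d0]; first by rewrite mul0r.
  by case: H; exists y.
rewrite -lte_fin expectE//; apply: (@lt_le_trans _ _ (d y * f y)%:E).
  by rewrite lte_fin mulr_gt0.
apply: esum_ge; exists [set y]; first by split; [exact: finite_set1|].
by rewrite fsbig_set1.
Qed.

Lemma distr_supp d : exists y, 0 < d y.
Proof.
have [+ _] := expect_gt0P d unit_cst1.
by rewrite expect_cst1 => /(_ ltr01)[y]; exists y.
Qed.

(** Monotone convergence: a finite partial sum of the expectation of [f] involves finitely many
    states, and one index [N] brings [F N] within [e] of [f] on all of them. *)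
Lemma expect_lim d f (F : nat -> S -> R) (c : R) : unit_valued f ->
  (forall n, unit_valued (F n)) -> (forall x n, F n x <= F n.+1 x) ->
  (forall x e, 0 < e -> exists n, f x <= F n x + e) ->
  (forall n, expect d (F n) <= c) -> expect d f <= c.
Proof.
move=> fu Fu Fnd Ff Fc.
have Fmon x : {homo F^~ x : n m / (n <= m)%N >-> n <= m}.
  by apply: homo_leq => //; exact: le_trans.
apply/ler_addgt0Pr => e e0; rewrite -lee_fin expectE//.
apply: ge_ereal_sup => _ [X [finX _] <-].
rewrite fsbig_finite//=; set s := finmap.enum_fset _.
have [N HN] : exists N, forall y, y \in s -> f y <= F N y + e.
  elim: s => [|y s [N IH]]; first by exists 0%N.
  have [M HM] := Ff y e e0; exists (maxn N M) => z.
  rewrite in_cons => /orP[/eqP->|/IH H].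
    by apply: le_trans HM _; rewrite lerD2r; apply: Fmon; exact: leq_maxr.
  by apply: le_trans H _; rewrite lerD2r; apply: Fmon; exact: leq_maxl.
(* Capping by [f] keeps [g] unit valued, and [g] still equals [f] on the states of [s]. *)
pose g x := Num.min (f x) (F N x + e).
have gu : unit_valued g.
  move=> x; rewrite /g; have /andP[? ?] := fu x; have /andP[? ?] := Fu N x.
  by rewrite le_min ge_min; apply/andP; split; lra.
apply: (@le_trans _ _ (expect d g)%:E); last first.
  rewrite lee_fin; apply: (@le_trans _ _ (expect d (F N) + e)).
    apply: expect_le_add => //; first exact: ltW.
    by move=> x; rewrite /g ge_min lexx orbT.
  by rewrite lerD2r.
rewrite expectE//; apply: esum_ge; exists X => //.
rewrite fsbig_finite//= -/s big_seq [leRHS]big_seq; apply: lee_sum => y ys.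
by rewrite lee_fin /g min_l// HN.
Qed.

End Expectation.

(** * The modalities, their duality and their qualitative values *)

Section Modalities.
Context (R : realType) (S : choiceType) (step : S -> set (distr R S)).
Implicit Types (d : distr R S) (f g : S -> R).

Let sup_expect f x : unit_valued f -> step x !=set0 ->
  has_sup [set expect d f | d in step x].
Proof.
move=> fu [d xd]; split; first by exists (expect d f); exists d.
by exists 1 => _ [d' _ <-]; exact: expect_le1.
Qed.

Let inf_expect f x : unit_valued f -> step x !=set0 ->
  has_inf [set expect d f | d in step x].
Proof.
move=> fu [d xd]; split; first by exists (expect d f); exists d.
by exists 0 => _ [d' _ <-]; exact: expect_ge0.
Qed.

Lemma dia_ge f x d : unit_valued f -> step x d -> expect d f <= dia_sem step f x.
Proof.
move=> fu xd; have x0 : step x !=set0 by exists d.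
rewrite /dia_sem asboolT//; apply: ub_le_sup; first exact: (sup_expect fu x0).2.
by exists d.
Qed.

Lemma dia_le f x (c : R) : 0 <= c -> (forall d, step x d -> expect d f <= c) ->
  dia_sem step f x <= c.
Proof.
move=> c0 H; rewrite /dia_sem; case: asboolP => // -[d xd].
apply: ge_sup; first by exists (expect d f); exists d.
by move=> _ [d' xd' <-]; exact: H.
Qed.

Lemma box_le f x d : unit_valued f -> step x d -> box_sem step f x <= expect d f.
Proof.
move=> fu xd; have x0 : step x !=set0 by exists d.
rewrite /box_sem asboolT//; apply: ge_inf; first exact: (inf_expect fu x0).2.
by exists d.
Qed.

Lemma box_ge f x (c : R) : c <= 1 -> (forall d, step x d -> c <= expect d f) ->
  c <= box_sem step f x.
Proof.
move=> c0 H; rewrite /box_sem; case: asboolP => // -[d xd].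
apply: lb_le_inf; first by exists (expect d f); exists d.
by move=> _ [d' xd' <-]; exact: H.
Qed.

Lemma box_adherent f x (e : R) : unit_valued f -> step x !=set0 -> 0 < e ->
  exists2 d, step x d & expect d f <= box_sem step f x + e.
Proof.
move=> fu x0 e0; rewrite /box_sem asboolT//.
have [_ [d xd <-] lt] := inf_adherent e0 (inf_expect fu x0).
by exists d => //; exact: ltW.
Qed.

Lemma unit_dia f : unit_valued f -> unit_valued (dia_sem step f).
Proof.
move=> fu x; apply/andP; split; last by apply: dia_le => // d _; exact: expect_le1.
have [[d xd]|n0] := pselect (step x !=set0); last by rewrite /dia_sem asboolF.
exact: le_trans (expect_ge0 d fu) (dia_ge fu xd).
Qed.

(** Duality extends to dead states, because the values 0 of an empty supremum and 1 of an empty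
    infimum are complementary. *)
Lemma dia_compl f : unit_valued f ->
  dia_sem step (fun x => 1 - f x) = fun x => 1 - box_sem step f x.
Proof.
move=> fu; apply/funext => x; have fu' := unit_compl fu.
apply/eqP; rewrite eq_le; apply/andP; split; last first.
  rewrite lerBlDr -lerBlDl; apply: box_ge => [|d xd].
    by rewrite gerBl; case/andP: (unit_dia fu' x).
  by rewrite lerBlDl -lerBlDr -expect_compl//; exact: dia_ge.
apply: dia_le => [|d xd].
  rewrite subr_ge0; have [[d xd]|n0] := pselect (step x !=set0).
    exact: le_trans (box_le fu xd) (expect_le1 d fu).
  by rewrite /box_sem asboolF.
by rewrite expect_compl// lerD2l lerN2 box_le.
Qed.

Lemma box_compl f : unit_valued f ->
  box_sem step (fun x => 1 - f x) = fun x => 1 - dia_sem step f x.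
Proof.
move=> fu; have := dia_compl (unit_compl fu).
have -> : (fun x => 1 - (1 - f x)) = f by apply/funext => x; rewrite subKr.
by move=> ->; apply/funext => x; rewrite subKr.
Qed.

Lemma unit_box f : unit_valued f -> unit_valued (box_sem step f).
Proof.
move=> fu; have -> : box_sem step f = fun x => 1 - dia_sem step (fun y => 1 - f y) x.
  by rewrite dia_compl//; apply/funext => x; rewrite subKr.
by apply: unit_compl; apply: unit_dia; exact: unit_compl.
Qed.

Lemma dia_mono f g : unit_valued f -> unit_valued g -> (forall x, f x <= g x) ->
  forall x, dia_sem step f x <= dia_sem step g x.
Proof.
move=> fu gu fg x; apply: dia_le => [|d xd]; first by case/andP: (unit_dia gu x).
exact: le_trans (expect_le d fu gu fg) (dia_ge gu xd).
Qed.

Lemma box_mono f g : unit_valued f -> unit_valued g -> (forall x, f x <= g x) ->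
  forall x, box_sem step f x <= box_sem step g x.
Proof.
move=> fu gu fg x; apply: box_ge => [|d xd]; first by case/andP: (unit_box fu x).
exact: le_trans (box_le fu xd) (expect_le d fu gu fg).
Qed.

Lemma dia_gt0P f x : unit_valued f ->
  0 < dia_sem step f x <-> exists2 y, leads step x y & 0 < f y.
Proof.
move=> fu; split=> [|[y [d xd dy] fy]].
  apply: contraPP => H; apply/negP; rewrite -leNgt; apply: dia_le => // d xd.
  rewrite leNgt; apply/negP => /expect_gt0P -/(_ fu)[y dy fy].
  by apply: H; exists y => //; exists d.
apply: lt_le_trans (dia_ge fu xd); apply/expect_gt0P => //.
by exists y.
Qed.

Lemma dia_cst1 x : dia_sem step (fun=> 1) x = if `[< step x !=set0 >] then 1 else 0.
Proof.
rewrite /dia_sem; case: asboolP => // -[d xd].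
rewrite (_ : [set _ | _ in _] = [set 1]) ?sup1//.
apply/seteqP; split=> [_ [d' _ <-]|_ ->] /=; rewrite ?expect_cst1//.
by exists d => //; rewrite expect_cst1.
Qed.

Definition boxdot_sem f x : R :=
  Num.min (box_sem step f x) (dia_sem step (fun=> 1) x).

Lemma boxdotE f x : unit_valued f -> boxdot_sem f x =
  if `[< step x !=set0 >] then box_sem step f x else 0.
Proof.
move=> fu; rewrite /boxdot_sem dia_cst1.
by have /andP[? ?] := unit_box fu x; case: ifP => _; [exact: min_l|exact: min_r].
Qed.

Lemma unit_boxdot f : unit_valued f -> unit_valued (boxdot_sem f).
Proof.
move=> fu x; rewrite boxdotE//; case: ifP => _; last by rewrite lexx ler01.
exact: unit_box.
Qed.

Lemma boxdot_mono f g : unit_valued f -> unit_valued g -> (forall x, f x <= g x) ->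
  forall x, boxdot_sem f x <= boxdot_sem g x.
Proof. by move=> fu gu fg x; rewrite !boxdotE//; case: ifP => // _; exact: box_mono. Qed.

Lemma leads_step x : step x !=set0 <-> exists y, leads step x y.
Proof.
split=> [[d xd]|[y [d xd _]]]; last by exists d.
by have [y dy] := distr_supp d; exists y; exists d.
Qed.

(** By duality with [dia_gt0P]: an infimum equal to 1, like a supremum above 0, is decided by single
    successors, without any limit. The existence of a successor reflects the value 0 of [boxdot_sem]
    at dead states. *)
Lemma boxdot_eq1P f x : unit_valued f ->
  boxdot_sem f x = 1 <->
  (exists y, leads step x y) /\ forall y, leads step x y -> f y = 1.
Proof.
move=> fu; rewrite -leads_step boxdotE//; case: asboolP => [x0|n0]; last first.
  by split=> [/eqP|[]//]; rewrite eq_sym oner_eq0.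
have /andP[_ b1] := unit_box fu x.
have := dia_gt0P x (unit_compl fu); rewrite dia_compl// subr_gt0 => -[H1 H2].
split=> [b|[_ H]].
  split=> // y xy; apply/eqP; apply: contra_eqT b => fy; rewrite lt_eqF//.
  apply: H2; exists y => //; rewrite subr_gt0 lt_neqAle fy.
  by case/andP: (fu y).
apply/eqP; rewrite eq_le b1 leNgt; apply/negP => /H1[y /H->].
by rewrite subrr ltxx.
Qed.

End Modalities.

(** * Fixed points, duality and thresholds *)

Section FixedPoints.
Context (R : realType) (S : choiceType).
Implicit Types (f g h : S -> R) (F G : (S -> R) -> (S -> R)).

Lemma lfpE F f : is_lfp F f -> lfp F = f.
Proof.
move=> Ff; apply: xget_unique => // g [gu Fg gl]; have [fu Ffe fl] := Ff.
by apply/funext => x; apply/eqP; rewrite eq_le gl// fl.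
Qed.

Lemma gfpE F f : is_gfp F f -> gfp F = f.
Proof.
move=> Ff; apply: xget_unique => // g [gu Fg gl]; have [fu Ffe fl] := Ff.
by apply/funext => x; apply/eqP; rewrite eq_le gl// fl.
Qed.

Lemma unit_lfp F : unit_valued (lfp F).
Proof. by rewrite /lfp; case: xgetP => [f -> []//|_]; exact: unit_cst0. Qed.

Lemma unit_gfp F : unit_valued (gfp F).
Proof. by rewrite /gfp; case: xgetP => [f -> []//|_]; exact: unit_cst1. Qed.

Lemma is_lfp_eq F G f : (forall h, unit_valued h -> F h = G h) ->
  is_lfp F f -> is_lfp G f.
Proof.
move=> FG [fu Ff fl]; split=> //; first by rewrite -FG.
by move=> g gu Gg; apply: fl => //; rewrite FG.
Qed.

Lemma eq_lfp F G : (forall h, unit_valued h -> F h = G h) -> lfp F = lfp G.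
Proof.
move=> FG; congr xget; apply/seteqP; split=> f; apply: is_lfp_eq => // h hu.
by rewrite FG.
Qed.

Lemma is_lfp_compl F G f :
  (forall h, unit_valued h -> G (fun x => 1 - h x) = fun x => 1 - F h x) ->
  is_lfp F f -> is_gfp G (fun x => 1 - f x).
Proof.
move=> FG [fu Ff fl]; split; first exact: unit_compl.
  by rewrite FG// Ff.
move=> g gu Gg x; rewrite lerBrDl -lerBrDr.
apply: (fl (fun x => 1 - g x)); first exact: unit_compl.
have gg : (fun x => 1 - (1 - g x)) = g by apply/funext => y; rewrite subKr.
have := FG _ (unit_compl gu); rewrite gg Gg => e.
by apply/funext => y; rewrite [in RHS]e subKr.
Qed.

Lemma is_gfp_compl F G f :
  (forall h, unit_valued h -> G (fun x => 1 - h x) = fun x => 1 - F h x) ->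
  is_gfp F f -> is_lfp G (fun x => 1 - f x).
Proof.
move=> FG [fu Ff fl]; split; first exact: unit_compl.
  by rewrite FG// Ff.
move=> g gu Gg x; rewrite lerBlDr -lerBlDl.
apply: (fl (fun x => 1 - g x)); first exact: unit_compl.
have gg : (fun x => 1 - (1 - g x)) = g by apply/funext => y; rewrite subKr.
have := FG _ (unit_compl gu); rewrite gg Gg => e.
by apply/funext => y; rewrite [in RHS]e subKr.
Qed.

(* The default values of [lfp] and [gfp] are complementary too, so that neither
   fixed point needs to exist. *)
Lemma gfp_compl F G :
  (forall h, unit_valued h -> G (fun x => 1 - h x) = fun x => 1 - F h x) ->
  gfp G = fun x => 1 - lfp F x.
Proof.
move=> FG; have GF h : unit_valued h ->
    F (fun x => 1 - h x) = fun x => 1 - G h x.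
  move=> hu; have := FG _ (unit_compl hu).
  rewrite (_ : (fun x => 1 - (1 - h x)) = h); last first.
    by apply/funext => x; rewrite subKr.
  by move=> ->; apply/funext => x; rewrite subKr.
rewrite {1}/gfp; case: xgetP => [g _ Gg|nG].
  rewrite (lfpE (is_gfp_compl GF Gg)).
  by apply/funext => x; rewrite subKr.
rewrite /lfp; case: xgetP => [f _ Ff|_]; last first.
  by apply/funext => x; rewrite subr0.
by case: (nG _ (is_lfp_compl FG Ff)).
Qed.

Lemma lfp_compl F G :
  (forall h, unit_valued h -> G (fun x => 1 - h x) = fun x => 1 - F h x) ->
  lfp G = fun x => 1 - gfp F x.
Proof.
move=> FG; rewrite (@gfp_compl G F); first by apply/funext => x; rewrite subKr.
move=> h hu; have := FG _ (unit_compl hu).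
rewrite (_ : (fun x => 1 - (1 - h x)) = h); last first.
  by apply/funext => x; rewrite subKr.
by move=> ->; apply/funext => x; rewrite subKr.
Qed.

(* If F f <= f then F f is itself a prefixed point by monotonicity, so that a
   least prefixed point is a fixed point. *)
Lemma lfp_prefixed F f :
  (forall h, unit_valued h -> unit_valued (F h)) ->
  (forall g h, unit_valued g -> unit_valued h -> (forall x, g x <= h x) ->
    forall x, F g x <= F h x) ->
  unit_valued f -> (forall x, F f x <= f x) ->
  (forall g, unit_valued g -> (forall x, F g x <= g x) -> forall x, f x <= g x) ->
  lfp F = f.
Proof.
move=> Fu Fmono fu Ff fl; apply: lfpE; split=> //.
  apply/funext => x; apply/eqP; rewrite eq_le Ff/= fl//; first exact: Fu.
  by apply: Fmono => //; exact: Fu.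
by move=> g gu Fg; apply: fl => // x; rewrite Fg.
Qed.

End FixedPoints.

(** * Semantics of formulas: fresh variables, duality, thresholds *)

Section Semantics.
Context (R : realType) (S : choiceType) (step : S -> set (distr R S)).
Context (A : Type) (rho : A -> S -> R).
Hypothesis rho_unit : forall P, unit_valued (rho P).
Implicit Types (f g : lmu A) (v : nat -> S -> R) (q : {i01 rat}).

Lemma unit_upd v X (h : S -> R) : (forall Y, unit_valued (v Y)) ->
  unit_valued h -> forall Y, unit_valued ([eta v with X |-> h] Y).
Proof. by move=> vu hu Y /=; case: eqP. Qed.

Lemma ratr_i01 q : 0 <= ratr q%:num :> R /\ ratr q%:num <= 1 :> R.
Proof.
split; first by rewrite ler0q.
by rewrite -(@rmorph1 _ _ (@ratr R)) ler_rat.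
Qed.

Lemma unit_sem v f : (forall Y, unit_valued (v Y)) ->
  unit_valued (lmu_sem step rho v f).
Proof.
elim: f v => [X|P|P|q g IH|g IHg h IHh|g IHg h IHh|g IHg h IHh|g IHg h IHh
  |g IH|g IH|X g IH|X g IH] v vu //=.
- exact: unit_compl.
- move=> x; have /andP[g0 g1] := IH v vu x; have [q0 q1] := ratr_i01 q.
  by rewrite mulr_ge0//= mulr_ile1.
- move=> x; have /andP[g0 g1] := IHg v vu x; have /andP[h0 h1] := IHh v vu x.
  by rewrite le_max ge_max g0 g1.
- move=> x; have /andP[g0 g1] := IHg v vu x; have /andP[h0 h1] := IHh v vu x.
  by rewrite le_min ge_min g0 g1 h0.
- move=> x; have /andP[g0 g1] := IHg v vu x; have /andP[h0 h1] := IHh v vu x.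
  by rewrite le_min ge_min lexx ler01 addr_ge0.
- move=> x; have /andP[g0 g1] := IHg v vu x; have /andP[h0 h1] := IHh v vu x.
  by rewrite le_max ge_max lexx ler01/=; lra.
- exact: unit_dia (IH v vu).
- exact: unit_box (IH v vu).
- exact: unit_lfp.
- exact: unit_gfp.
Qed.

(** Only variables below [fresh f] occur in [f]; hence the threshold modalities may bind [fresh f]
    around [f] without capture. *)
Lemma sem_fresh v v' f : (forall Y, (Y < fresh f)%N -> v Y = v' Y) ->
  lmu_sem step rho v f = lmu_sem step rho v' f.
Proof.
have upd X g : (forall v v', (forall Y, (Y < fresh g)%N -> v Y = v' Y) ->
      lmu_sem step rho v g = lmu_sem step rho v' g) ->
    forall v v', (forall Y, (Y < maxn X.+1 (fresh g))%N -> v Y = v' Y) ->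
    (fun h => lmu_sem step rho [eta v with X |-> h] g) =
    (fun h => lmu_sem step rho [eta v' with X |-> h] g).
  move=> IH w w' ww; apply/funext => h; apply: IH => Y Yg /=.
  by case: eqP => // _; apply: ww; rewrite leq_max Yg orbT.
elim: f v v' => [X|P|P|q g IH|g IHg h IHh|g IHg h IHh|g IHg h IHh|g IHg h IHh
  |g IH|g IH|X g IH|X g IH] v v' vv //=.
all: try by rewrite (IH _ _ vv).
all: try by rewrite (upd _ _ IH _ _ vv).
- by rewrite vv/=.
all: by rewrite (IHg v v') ?(IHh v v')// => Y Yg; apply: vv; rewrite leq_max Yg ?orbT.
Qed.

Lemma sem_upd_fresh v f (h : S -> R) X : (fresh f <= X)%N ->
  lmu_sem step rho [eta v with X |-> h] f = lmu_sem step rho v f.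
Proof. by move=> fX; apply: sem_fresh => Y Yf /=; rewrite ltn_eqF// (leq_trans Yf). Qed.

Lemma sem_one v : lmu_sem step rho v (one_f A) = fun=> 1.
Proof.
apply: gfpE; split=> //; first exact: unit_cst1.
by move=> g gu _ x; case/andP: (gu x).
Qed.

(* Duality is complementation only for such formulas: dual (q f) is (1 - q) f. *)
Fixpoint scal_const f : Prop :=
  match f with
  | Var _ | Lit _ | NLit _ => True
  | Scal q g => g = one_f A
  | Dia g | Box g | Mu _ g | Nu _ g => scal_const g
  | Max g h | Min g h | Oplus g h | Odot g h => scal_const g /\ scal_const h
  end.

Lemma scal_const_dual f : scal_const f -> scal_const (dual f).
Proof. by elim: f => //= g IHg h IHh [/IHg ? /IHh]. Qed.

(** Each connective has its De Morgan dual. The valuation is complemented as well, so that the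
    induction passes under binders. *)
Lemma sem_dual v f : (forall Y, unit_valued (v Y)) -> scal_const f ->
  lmu_sem step rho (fun X x => 1 - v X x) (dual f) =
  fun x => 1 - lmu_sem step rho v f x.
Proof.
have upd X g : (forall v, (forall Y, unit_valued (v Y)) -> scal_const g ->
      lmu_sem step rho (fun X x => 1 - v X x) (dual g) =
      fun x => 1 - lmu_sem step rho v g x) ->
    forall v, (forall Y, unit_valued (v Y)) -> scal_const g ->
    forall h, unit_valued h ->
    lmu_sem step rho [eta (fun X x => 1 - v X x) with X |-> fun x => 1 - h x] (dual g) =
    fun x => 1 - lmu_sem step rho [eta v with X |-> h] g x.
  move=> IH w wu gs h hu; rewrite -IH//; last exact: unit_upd.
  congr (lmu_sem _ _ _ _); apply/funext => Y /=.
  by case: eqP.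
elim: f v => [X|P|P|q g IH|g IHg h IHh|g IHg h IHh|g IHg h IHh|g IHg h IHh
  |g IH|g IH|X g IH|X g IH] v vu //=.
- by move=> _; apply/funext => x; rewrite subKr.
- move=> ->; rewrite !sem_one; apply/funext => x.
  by rewrite /= rmorphB rmorph1 !mulr1.
all: try by (move=> [gs hs]; rewrite IHg// IHh//; apply/funext => x;
  move: (lmu_sem _ _ _ _ _) (lmu_sem _ _ _ _ _) => a b;
  rewrite /Num.max /Num.min; do ![case: ifPn => //]; rewrite -?leNgt; lra).
- by move=> gs; rewrite IH// box_compl//; exact: unit_sem.
- by move=> gs; rewrite IH// dia_compl//; exact: unit_sem.
- by move=> gs; apply: gfp_compl => h hu; exact: upd.
- by move=> gs; apply: lfp_compl => h hu; exact: upd.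
Qed.

Lemma sem_mu_fresh v f (op : lmu A -> lmu A -> lmu A) (o : R -> R -> R) (h : S -> R) :
  (forall w g g', lmu_sem step rho w (op g g') =
    fun x => o (lmu_sem step rho w g x) (lmu_sem step rho w g' x)) ->
  lmu_sem step rho [eta v with fresh f |-> h] (op (Var (fresh f)) f) =
  fun x => o (h x) (lmu_sem step rho v f x).
Proof.
move=> opE; rewrite opE (sem_upd_fresh v h (leqnn _)); apply/funext => x.
by rewrite /= eqxx.
Qed.

(** The equation h = min(1, h + f) is pointwise: where f > 0 it forces h = 1; where f = 0 every
    value solves it and the least is 0. *)
Lemma sem_prob_gt0 v f : (forall Y, unit_valued (v Y)) ->
  lmu_sem step rho v (prob_gt0 f) = \1_[set x | 0 < lmu_sem step rho v f x].
Proof.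
move=> vu; have fu := unit_sem f vu.
transitivity (lfp (fun h x => Num.min 1 (h x + lmu_sem step rho v f x))).
  congr lfp; apply/funext => h.
  exact: (@sem_mu_fresh v f (@Oplus A) (fun a b => Num.min 1 (a + b))).
apply: lfpE; split; first exact: unit_indic.
  apply/funext => x; rewrite indicE; have /andP[f0 f1] := fu x.
  have [] := boolP (x \in _); rewrite ?inE ?notin_setE/= => H.
    by rewrite min_l//; lra.
  by rewrite min_r; lra.
move=> g gu + x => /(congr1 (@^~ x)) /=; rewrite indicE.
have [] := boolP (x \in _); rewrite ?inE ?notin_setE/= => H.
  by rewrite /Num.min; case: ifPn; lra.
by case/andP: (gu x).
Qed.

(** Dually, h = max(0, h + f - 1) forces h = 0 where f < 1; where f = 1 every value solves it and
    the greatest is 1. *)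
Lemma sem_prob_eq1 v f : (forall Y, unit_valued (v Y)) ->
  lmu_sem step rho v (prob_eq1 f) = \1_[set x | lmu_sem step rho v f x = 1].
Proof.
move=> vu; have fu := unit_sem f vu.
transitivity (gfp (fun h x => Num.max 0 (h x + lmu_sem step rho v f x - 1))).
  congr gfp; apply/funext => h.
  exact: (@sem_mu_fresh v f (@Odot A) (fun a b => Num.max 0 (a + b - 1))).
apply: gfpE; split; first exact: unit_indic.
  apply/funext => x; rewrite indicE; have /andP[f0 f1] := fu x.
  have [] := boolP (x \in _); rewrite ?inE ?notin_setE/= => H.
    by rewrite H max_r//; lra.
  by rewrite max_l//; lra.
move=> g gu + x => /(congr1 (@^~ x)) /=; rewrite indicE.
have /andP[f0 f1] := fu x; have /andP[g0 g1] := gu x.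
have [//|] := boolP (x \in _); rewrite ?notin_setE/= => /eqP.
rewrite neq_lt [_ < lmu_sem _ _ _ _ _]ltNge f1 orbF => H.
by rewrite /Num.max; case: ifPn; lra.
Qed.

Lemma sem_const v q : lmu_sem step rho v (const_f A q) = fun=> ratr q%:num.
Proof.
transitivity (fun x => ratr q%:num * lmu_sem step rho v (one_f A) x); first by [].
by rewrite sem_one; apply/funext => x; rewrite mulr1.
Qed.

Definition cmp_real (c : cmp) (a : R) q : Prop :=
  match c with Gt => ratr q%:num < a | Ge => ratr q%:num <= a end.

(** The constant 1 - q shifts the threshold: max(0, f + (1 - q) - 1) is positive iff f > q, and
    min(1, f + (1 - q)) is 1 iff f >= q. *)
Lemma sem_prob_cmp v c q f : (forall Y, unit_valued (v Y)) ->
  lmu_sem step rho v (prob_cmp c q f) =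
  \1_[set x | cmp_real c (lmu_sem step rho v f x) q].
Proof.
move=> vu; have fu := unit_sem f vu; have [q0 q1] := ratr_i01 q.
have rC : ratr (1 - q%:num)%:i01%:num = 1 - ratr q%:num :> R.
  by rewrite /= rmorphB rmorph1.
case: c; rewrite /prob_cmp /cmp_real.
- rewrite /prob_gt; case: eqP => [->|/eqP qn0].
    by rewrite [ratr 0]rmorph0 sem_prob_gt0.
  case: eqP => [->|/eqP qn1].
    rewrite [ratr 1]rmorph1; apply/funext => x.
    rewrite sem_const [LHS]rmorph0 indicE memNset//=.
    by have /andP[_ f1] := fu x; apply/negP; rewrite -leNgt.
  rewrite sem_prob_gt0//; congr (\1_ _).
  have odotE x : lmu_sem step rho v (Odot f (const_f A (1 - q%:num)%:i01)) x =
      Num.max 0 (lmu_sem step rho v f x - ratr q%:num).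
    transitivity (Num.max 0 (lmu_sem step rho v f x +
      lmu_sem step rho v (const_f A (1 - q%:num)%:i01) x - 1)); first by [].
    by rewrite sem_const rC; congr Num.max; lra.
  by apply/seteqP; split=> x; rewrite /mkset odotE lt_max ltxx/= subr_gt0.
- rewrite /prob_ge; case: eqP => [->|/eqP qn1].
    rewrite [ratr 1]rmorph1 sem_prob_eq1//; congr (\1_ _).
    apply/seteqP; split=> x /= ; first by move=> ->.
    by have /andP[_ f1] := fu x => H; apply/eqP; rewrite eq_le f1.
  case: eqP => [->|/eqP qn0].
    rewrite [ratr 0]rmorph0; apply/funext => x; rewrite sem_one indicE mem_set//=.
    by have /andP[f0 _] := fu x.
  rewrite sem_prob_eq1//; congr (\1_ _).
  have oplusE x : lmu_sem step rho v (Oplus f (const_f A (1 - q%:num)%:i01)) x =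
      Num.min 1 (lmu_sem step rho v f x + (1 - ratr q%:num)).
    transitivity (Num.min 1 (lmu_sem step rho v f x +
      lmu_sem step rho v (const_f A (1 - q%:num)%:i01) x)); first by [].
    by rewrite sem_const rC.
  by apply/seteqP; split=> x; rewrite /mkset oplusE /Num.min; case: ifPn; lra.
Qed.

End Semantics.

(** * Qualitative path formulas *)

Section UntilOperator.
Context (R : realType) (S : choiceType) (B1 B2 : set S).
Implicit Types (f g h : S -> R) (nxt : (S -> R) -> (S -> R)).

(** The operator behind [until_f] for an arbitrary one-step operator [nxt], so that [dia_sem],
    [boxdot_sem] and their qualitative versions share one fixed point criterion. *)
Definition until_op nxt h x : R := Num.max (\1_B2 x) (Num.min (\1_B1 x) (nxt h x)).

Lemma until_op_le nxt h (V : S -> R) x : unit_valued (nxt h) -> unit_valued V ->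
  (B2 x -> V x = 1) -> (B1 x -> ~ B2 x -> nxt h x <= V x) -> until_op nxt h x <= V x.
Proof.
move=> hu Vu V2 V1; rewrite /until_op !indicE; have /andP[V0 V1'] := Vu x.
have /andP[h0 h1] := hu x.
have [b2|nb2] := pselect (B2 x).
  rewrite (mem_set b2) V2// ge_max lexx ge_min.
  by case: (x \in B1); rewrite /= ?lexx ?ler01.
rewrite (memNset nb2) ge_max V0 /= ge_min.
have [b1|nb1] := pselect (B1 x); first by rewrite V1// orbT.
by rewrite (memNset nb1) V0.
Qed.

Lemma until_op_ge nxt h x : unit_valued (nxt h) ->
  (B2 x -> until_op nxt h x = 1) /\ (B1 x -> nxt h x <= until_op nxt h x).
Proof.
move=> hu; have /andP[h0 h1] := hu x; rewrite /until_op !indicE; split=> b.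
  by rewrite mem_set// max_l// ge_min; case: (x \in B1); rewrite /= ?lexx ?ler01.
by rewrite (mem_set b) le_max (@min_r _ _ (true%:R) (nxt h x))// lexx orbT.
Qed.

(** The conditions are those that paths and schedulers deliver directly, on [B2] and on [B1]; that
    [V] vanishes elsewhere follows from its minimality. *)
Lemma until_lfp nxt (V : S -> R) :
  (forall h, unit_valued h -> unit_valued (nxt h)) ->
  (forall g h, unit_valued g -> unit_valued h -> (forall x, g x <= h x) ->
    forall x, nxt g x <= nxt h x) ->
  unit_valued V -> (forall x, B2 x -> V x = 1) ->
  (forall x, B1 x -> ~ B2 x -> nxt V x <= V x) ->
  (forall g, unit_valued g -> (forall x, B2 x -> g x = 1) ->
    (forall x, B1 x -> nxt g x <= g x) -> forall x, V x <= g x) ->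
  lfp (until_op nxt) = V.
Proof.
move=> nu nmono Vu V2 V1 Vmin; apply: lfp_prefixed => //.
- move=> h hu x; have /andP[? ?] := nu h hu x; rewrite /until_op.
  have /andP[? ?] := @unit_indic R S B1 x; have /andP[? ?] := @unit_indic R S B2 x.
  by rewrite le_max ge_max ge_min; do 3?[apply/andP; split]; do ?[apply/orP; left].
- move=> g h gu hu gh x; rewrite /until_op ge_max le_max lexx/= le_max.
  by rewrite le_min !ge_min lexx/= nmono// !orbT.
- by move=> x; apply: until_op_le => //; [exact: nu|exact: V2|exact: V1].
- move=> g gu Fg; apply: Vmin => // x b; have [H2 H1] := until_op_ge x (nu g gu).
    by apply/eqP; rewrite eq_le -{2}H2// Fg andbT; case/andP: (gu x).
  exact: le_trans (H1 b) (Fg x).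
Qed.

End UntilOperator.

Section PathSets.
Context (R : realType) (S : choiceType) (step : S -> set (distr R S)).
Implicit Types (B : set S) (p q : mpath step).

Definition next_set B : set (mpath step) := [set p | exists2 y, p 1%N = Some y & B y].

Definition until_set B1 B2 : set (mpath step) :=
  [set p | exists n, (exists2 y, p n = Some y & B2 y) /\
    (forall m, (m < n)%N -> exists2 y, p m = Some y & B1 y)].

Lemma cylinder1 x p : cylinder [:: x] p <-> p 0%N = Some x.
Proof. by split=> [/(_ 0%N)->//|p0 [|]]. Qed.

Lemma mpath_cons x y p : leads step x y -> p 0%N = Some y ->
  exists q : mpath step, q 0%N = Some x /\ forall n, q n.+1 = p n.
Proof.
move=> xy p0; pose q n := if n is m.+1 then p m else Some x.
have qP : is_mpath step q.
  split=> // -[|n] /=; first by rewrite p0.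
  by have [_ H] := mpathP p; exact: H.
by exists (MPath qP).
Qed.

Lemma mpath_tail p y : p 1%N = Some y -> exists q : mpath step, forall n, q n = p n.+1.
Proof.
move=> p1; have qP : is_mpath step (fun n => p n.+1).
  split=> [|n]; first by rewrite p1.
  by have [_ H] := mpathP p; exact: H.
by exists (MPath qP).
Qed.

Lemma mpath_choose (c : S -> S) x :
  (forall z y, leads step z y -> leads step z (c z)) ->
  exists p : mpath step, p 0%N = Some x /\
    forall n z y, p n = Some z -> p n.+1 = Some y -> y = c z.
Proof.
move=> cP.
pose nxt (o : option S) : option S :=
  if o is Some z then if `[< exists y, leads step z y >] then Some (c z) else None
  else None.
have pP : is_mpath step (fun n => iter n nxt (Some x)).
  split=> // n; rewrite iterS; case: (iter n nxt (Some x)) => [z|//] /=.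
  by case: asboolP => [[y /cP]//|ne y zy]; apply: ne; exists y.
exists (MPath pP); split=> // n z y /= -> /=.
by case: asboolP => // _ [].
Qed.

Lemma ex_next B x : (exists p, cylinder [:: x] p /\ next_set B p) <->
  exists2 y, leads step x y & B y.
Proof.
split=> [[p [/cylinder1 p0 [y p1 By]]]|[y xy By]].
  by exists y => //; exact: mpath_leads p0 p1.
have [p p0] := exists_mpath step y; have [q [q0 qp]] := mpath_cons xy p0.
by exists q; split; [exact/cylinder1|exists y => //; rewrite qp].
Qed.

Lemma all_next B x : (forall p, cylinder [:: x] p -> next_set B p) <->
  (exists y, leads step x y) /\ forall y, leads step x y -> B y.
Proof.
split=> [H|[[z xz] H] p /cylinder1 p0].
  split; last first.
    move=> y xy; have [p p0] := exists_mpath step y.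
    have [q [q0 qp]] := mpath_cons xy p0.
    have /H[z] : cylinder [:: x] q by exact/cylinder1.
    by rewrite qp p0 => -[->].
  have [p p0] := exists_mpath step x.
  have /H[y p1 By] : cylinder [:: x] p by exact/cylinder1.
  by exists y; exact: mpath_leads p0 p1.
case p1: (p 1%N) => [y|]; last by have := mpath_end p0 p1 xz.
by exists y => //; apply: H; exact: mpath_leads p0 p1.
Qed.

Lemma until_set0 B1 B2 p x : p 0%N = Some x -> B2 x -> until_set B1 B2 p.
Proof. by move=> p0 x2; exists 0%N; split=> //; exists x. Qed.

Lemma until_setS B1 B2 p q x : p 0%N = Some x -> (forall n, q n = p n.+1) ->
  B1 x -> until_set B1 B2 q -> until_set B1 B2 p.
Proof.
move=> p0 qp x1 [n [[y qy y2] H]]; exists n.+1; split.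
  by exists y => //; rewrite -qp.
move=> [_|m]; first by exists x.
by rewrite ltnS => /H[z qz z1]; exists z => //; rewrite -qp.
Qed.

(** Reachability is inductive: a first step can be put in front of a path, and any prefixed [g] is 1
    at the start of a path by induction on the position where [B2] is reached. *)
Lemma ex_until B1 B2 :
  lfp (until_op B1 B2 (fun h => \1_[set x | 0 < dia_sem step h x] : S -> R)) =
  \1_[set x | exists p, cylinder [:: x] p /\ until_set B1 B2 p].
Proof.
apply: until_lfp.
- by move=> h _; exact: unit_indic.
- move=> g h gu hu gh x; rewrite !indicE; have := dia_mono step gu hu gh x.
  have [|_ _] := boolP (x \in [set y | 0 < dia_sem step g y]); last by rewrite ler0n.
  by rewrite inE/= => g0 /(lt_le_trans g0) h0; rewrite mem_set.
- exact: unit_indic.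
- move=> x x2; rewrite indicE mem_set//.
  have [p p0] := exists_mpath step x; exists p.
  by split; [exact/cylinder1|exact: until_set0 p0 x2].
- move=> x x1 _; rewrite 2!indicE.
  have [|_] := boolP (x \in [set y | 0 < dia_sem step _ y]); last by rewrite ler0n.
  rewrite inE/= => /(dia_gt0P _ _ (@unit_indic _ _ _))[y xy].
  rewrite indicE; have [|] := boolP (y \in _); last by rewrite ltxx.
  rewrite inE => -[p [/cylinder1 p0 pU]] _; rewrite mem_set//=.
  have [q [q0 qp]] := mpath_cons xy p0; exists q.
  by split; [exact/cylinder1|exact: (until_setS q0 (fun n => esym (qp n)) x1 pU)].
- move=> g gu g2 g1 x; rewrite indicE; have /andP[g0 _] := gu x.
  have [|//] := boolP (x \in _); rewrite inE => -[p [/cylinder1 + [n [+ +]]]].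
  rewrite [leLHS]/= => {g0}; elim: n x p => [|n IH] x p p0 [y py y2] H.
    by move: py; rewrite p0 => -[->]; rewrite g2.
  have [z] := H 0%N (ltn0Sn _); rewrite p0 => -[<-] x1.
  have [w p1] : exists w, p 1%N = Some w.
    case: n py H {IH} => [py _|n _ H]; first by exists y.
    by have [w] := H 1%N isT; exists w.
  have [q qp] := mpath_tail p1.
  have gw : 1 <= g w.
    apply: (IH _ q); first by rewrite qp.
      by exists y => //; rewrite qp.
    by move=> m mn; rewrite qp; exact: H.
  apply: le_trans (g1 _ x1); rewrite indicE mem_set//=; apply/dia_gt0P => //.
  by exists w; [exact: mpath_leads p0 p1|exact: lt_le_trans gw].
Qed.

(** Suppose a prefixed [g] is below 1 at a state all of whose paths satisfy the property. At a [B1]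
    state with successors, a value of [g] below 1 passes on to some successor: otherwise
    [boxdot_sem step g] would be 1, and so would [g]. The maximal path that always makes this choice
    contradicts the property, as [g] is 1 on [B2]. *)
Lemma all_until B1 B2 :
  lfp (until_op B1 B2 (fun h => \1_[set x | boxdot_sem step h x = 1] : S -> R)) =
  \1_[set x | forall p, cylinder [:: x] p -> until_set B1 B2 p].
Proof.
apply: until_lfp.
- by move=> h _; exact: unit_indic.
- move=> g h gu hu gh x; rewrite !indicE; have := boxdot_mono step gu hu gh x.
  have [|_ _] := boolP (x \in [set y | boxdot_sem step g y = 1]); last by rewrite ler0n.
  rewrite inE/= => -> h1; rewrite mem_set//=; apply/eqP; rewrite eq_le h1 andbT.
  by case/andP: (unit_boxdot step hu x).
- exact: unit_indic.
- move=> x x2; rewrite indicE mem_set// => p /cylinder1 p0.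
  exact: until_set0 p0 x2.
- move=> x x1 _; rewrite 2!indicE.
  have [|_] := boolP (x \in [set y | boxdot_sem step _ y = 1]); last by rewrite ler0n.
  rewrite inE/= => /(boxdot_eq1P _ _ (@unit_indic _ _ _))[[z xz] H].
  rewrite mem_set//= => p /cylinder1 p0.
  case p1: (p 1%N) => [y|]; last by have := mpath_end p0 p1 xz.
  have [q qp] := mpath_tail p1; apply: (until_setS p0 qp x1).
  have /eqP := H _ (mpath_leads p0 p1).
  rewrite indicE pnatr_eq1 eqb1 inE => /(_ q); apply; apply/cylinder1.
  by rewrite qp.
- move=> g gu g2 g1 x; rewrite indicE; have /andP[g0 _] := gu x.
  have [|//] := boolP (x \in _); rewrite inE => xU; rewrite leNgt; apply/negP => gx.
  (* Two nested defaults: a successor with [g] below 1 if there is one, else any successor, else the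
     state itself. *)
  pose c z := xget (xget z [set y | leads step z y])
    [set y | leads step z y /\ g y < 1].
  have cP z y : leads step z y -> leads step z (c z).
    by move=> zy; rewrite /c; case: xgetP => [w _ []//|_]; case: xgetP => // /(_ y).
  have cg z : B1 z -> g z < 1 -> (exists y, leads step z y) -> g (c z) < 1.
    move=> z1 gz zs; rewrite /c; case: xgetP => [w _ []//|H].
    have : boxdot_sem step g z = 1.
      apply/boxdot_eq1P => //; split=> // y zy; apply/eqP; rewrite eq_le.
      have /andP[_ ->] := gu y; rewrite leNgt; apply/negP => gy.
      by apply: (H y).
    move=> b1; have := g1 _ z1; rewrite indicE mem_set//= leNgt => /negP[].
    exact: gz.
  have [p [p0 pc]] := mpath_choose x cP.
  have [n [[y py y2] H]] : until_set B1 B2 p by apply: xU; exact/cylinder1.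
  suff : g y < 1 by rewrite g2// ltxx.
  have : forall m, (m <= n)%N -> forall z, p m = Some z -> g z < 1; last first.
    by move=> /(_ n (leqnn _)); apply.
  elim=> [_ z|m IH mn z pz]; first by rewrite p0 => -[<-].
  have [w pw w1] := H m mn.
  rewrite (pc _ _ _ pw pz); apply: cg => //; first exact: IH (ltnW mn) _ pw.
  by exists z; exact: mpath_leads pw pz.
Qed.

End PathSets.

(** * Existence of path measures *)

Section Quantile.
Context (R : realType) (S : choiceType) (d : distr R S).

Lemma expect_add (f g : S -> R) : unit_valued f -> unit_valued g ->
  unit_valued (fun x => f x + g x) ->
  expect d (fun x => f x + g x) = expect d f + expect d g.
Proof.
move=> fu gu fgu; apply/eqP; rewrite -eqe EFinD !expectE// -esumD => [|y _|y _].
- by apply/eqP; apply: eq_esum => y _; rewrite mulrDr EFinD.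
- by rewrite lee_fin mulr_ge0 ?distr_ge0//; case/andP: (fu y).
- by rewrite lee_fin mulr_ge0 ?distr_ge0//; case/andP: (gu y).
Qed.

Lemma expect_set1 y : expect d \1_[set y] = d y.
Proof.
apply/eqP; rewrite -eqe expectE; last exact: unit_indic.
rewrite (_ : \esum_(_ in _) _ = \esum_(z in [set y]) (d z)%:E).
  by rewrite esum_set1// lee_fin distr_ge0.
rewrite [RHS]esum_mkcond; apply: eq_esum => z _.
by rewrite indicE; case: ifPn; rewrite ?mulr1 ?mulr0.
Qed.

(** Fewer than n + 1 points have mass above 1/(n+1), since n + 1 of them would exceed the total mass
    1; the support is the union of these finite sets. *)
Lemma distr_countable : countable [set y | 0 < d y].
Proof.
rewrite (_ : [set y | _] = \bigcup_n [set y | n.+1%:R^-1 < d y]).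
  apply: bigcup_countable => // n _; apply: finite_set_countable.
  apply: contrapT => /(infinite_set_fset n.+1)[X Xd cX].
  have /negP[] : ~~ (\esum_(y in [set: S]) (d y)%:E <= 1)%E; last by rewrite distr_sum1.
  rewrite -ltNge; set s := finmap.enum_fset X.
  have s1 : 1 < \sum_(y <- s) d y.
    have sd y : y \in s -> n.+1%:R^-1 < d y by move=> ys; apply: Xd.
    have ss : (n.+1 <= size s)%N by exact: cX.
    case: s ss sd {cX Xd} => // y0 s ss sd.
    rewrite -(@mulfV _ (n.+1%:R : R))// mulr_natl.
    apply: (@lt_le_trans _ _ (\sum_(y <- y0 :: s) d y)) => //.
    apply: (@le_lt_trans _ _ (\sum_(y <- y0 :: s) n.+1%:R^-1)).
      by rewrite big_const_seq count_predT iter_addr_0 ler_wpMn2l// invr_ge0.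
    rewrite !big_cons ltr_leD ?sd ?mem_head//.
    rewrite big_seq [leRHS]big_seq; apply: ler_sum => y ys.
    by rewrite ltW// sd// in_cons ys orbT.
  apply: (@lt_le_trans _ _ (\sum_(y <- s) (d y)%:E)%E).
    by rewrite sumEFin lte_fin.
  apply: esum_ge; exists [set y | y \in s].
    by split=> //; exact: finite_seq.
  by rewrite fsbig_seq// finmap.fset_uniq.
apply/seteqP; split=> [y /= dy|y [n _] /=]; last first.
  by apply: lt_trans; rewrite invr_gt0.
have [k] := ltr_add_invr dy; rewrite add0r => dk.
by exists k.
Qed.

(* [F] is the distribution function of [d] along an enumeration of its support. *)
Lemma distr_intervals : exists F : S -> R,
  [/\ forall y, 0 < d y -> 0 <= F y /\ F y + d y <= 1,
      forall u, 0 <= u < 1 -> exists y, 0 < d y /\ F y <= u < F y + d y &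
      forall u y z, 0 < d y -> 0 < d z -> F y <= u < F y + d y ->
        F z <= u < F z + d z -> y = z].
Proof.
have /countable_injP[e einj] := distr_countable.
have {}einj y z : 0 < d y -> 0 < d z -> e y = e z -> y = z.
  by move=> dy dz; apply: einj; rewrite inE.
(* [e] codes the support by natural numbers, possibly with gaps; [G n] is the mass of the points of
   code below [n]. *)
pose D n := [set z | 0 < d z /\ (e z < n)%N].
pose G n := expect d \1_(D n).
have Gle n m : (n <= m)%N -> G n <= G m.
  move=> nm; apply: expect_le; try exact: unit_indic.
  move=> x; rewrite !indicE; case: (boolP (x \in D n)); last by rewrite ler0n.
  rewrite inE => -[dx ex]; rewrite mem_set//.
  by split=> //; exact: leq_trans nm.
have G1 n : G n <= 1 by apply: expect_le1; exact: unit_indic.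
have G0 : G 0%N = 0.
  rewrite /G (_ : D 0%N = set0).
    apply/eqP; rewrite -eqe expectE; last exact: unit_indic.
    by rewrite esum1// => y _; rewrite indicE in_set0 mulr0.
  by apply/seteqP; split=> // z [].
have GS y : 0 < d y -> G (e y).+1 = G (e y) + d y.
  move=> dy; rewrite -[d y in RHS]expect_set1 -expect_add; try exact: unit_indic.
    congr expect; apply/funext => z; rewrite !indicE.
    have [zy|zy] := pselect (z = y).
      rewrite zy (_ : (y \in D (e y).+1) = true); last by rewrite mem_set//; split.
      rewrite (_ : (y \in D (e y)) = false); last first.
      by rewrite memNset// => -[_]; rewrite ltnn.
      by rewrite mem_set//= add0r.
    rewrite [z \in [set y]]memNset// addr0; congr (_%:R); congr nat_of_bool.
    apply/idP/idP; rewrite !inE => -[dz ez]; split=> //; last exact: ltnW.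
    move: ez; rewrite ltnS leq_eqVlt => /orP[/eqP ez|//].
    by case: zy; apply: einj.
  move=> z; rewrite !indicE; have [->|zy] := pselect (z = y).
    rewrite (_ : (y \in D (e y)) = false); last first.
      by rewrite memNset// => -[_]; rewrite ltnn.
    by rewrite mem_set//= add0r ler01 lexx.
  by rewrite [z \in [set y]]memNset// addr0; case: (_ \in _); rewrite ?lexx ler01.
have Gsup u : u < 1 -> exists n, u < G n.
  move=> u1; apply: contrapT => H.
  have {}H n : G n <= u by rewrite leNgt; apply/negP => ?; apply: H; exists n.
  have : expect d \1_[set z | 0 < d z] <= u.
    apply: (@expect_lim _ _ _ _ (fun n => \1_(D n))) => //.
    - exact: unit_indic.
    - by move=> n; exact: unit_indic.
    - move=> x n; rewrite !indicE; case: (boolP (x \in D n)); last by rewrite ler0n.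
      rewrite inE => -[dx ex]; rewrite mem_set//.
      by split=> //; exact: leqW.
    - move=> x eps e0; rewrite indicE.
      have [dx|dx] := pselect (0 < d x).
        exists (e x).+1; rewrite !indicE (_ : (x \in D _) = true); last first.
          by rewrite mem_set//; split.
        by rewrite mem_set// lerDl ltW.
      exists 0%N; rewrite memNset//; apply: addr_ge0; last exact: ltW.
      by rewrite ?indicE ler0n.
  rewrite (_ : expect _ _ = 1); first by rewrite leNgt u1.
  apply/eqP; rewrite -eqe expectE; last exact: unit_indic.
  rewrite -(distr_sum1 d); apply/eqP; apply: eq_esum => y _.
  rewrite indicE; have [dy|dy] := pselect (0 < d y); first by rewrite mem_set// mulr1.
  rewrite memNset// mulr0; congr EFin; apply/eqP; rewrite eq_le distr_ge0/= leNgt.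
  exact/negP.
exists (fun y => G (e y)); split.
- by move=> y dy; rewrite -GS// G1 -G0 Gle.
(* The least index at which [G] exceeds [u] is not 0 since [G 0] is 0; its predecessor [n] codes a
   point, because [G] does not increase across a gap. *)
- move=> u /andP[u0 u1]; have := Gsup u u1 => /ex_minnP[[|n]].
    by rewrite G0 ltNge u0.
  move=> un min; have Gn : G n <= u.
    by rewrite leNgt; apply/negP => /min; rewrite ltnn.
  have [[y [dy ey]]|H] := pselect (exists y, 0 < d y /\ e y = n).
    by exists y; split=> //; rewrite -GS// ey Gn.
  have : G n < G n.+1 by exact: le_lt_trans un.
  rewrite /G (_ : D n.+1 = D n) ?ltxx//.
  apply/seteqP; split=> z [dz ez]; split=> //; last exact: leqW.
  move: ez; rewrite ltnS leq_eqVlt => /orP[/eqP ez|//].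
  by case: H; exists z.
- move=> u y z dy dz /andP[yu uy] /andP[zu uz]; apply: einj => //.
  rewrite -GS// in uy; rewrite -GS// in uz.
  have H m n : G m <= u -> u < G n.+1 -> (m <= n)%N.
    move=> um un; rewrite leqNgt; apply/negP => /Gle.
    by rewrite leNgt (le_lt_trans um un).
  by apply/eqP; rewrite eqn_leq !H.
Qed.

End Quantile.

Section UniformMeasure.
Context (R : realType).

(** Half-open, like the intervals of [distr_intervals], which partition [0, 1[. *)
Definition unif01 : set (measurableTypeR R) -> \bar R :=
  mrestr (@lebesgue_measure R)
    (measurable_itv `[0%R, 1%R[ : measurable (_ : set (measurableTypeR R))).

HB.instance Definition _ := Measure.on unif01.

Let unif01_setT : unif01 setT = 1%E.
Proof.
by rewrite /unif01 /mrestr setTI lebesgue_measure_itv/= lte01 oppr0 adde0.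
Qed.

HB.instance Definition _ := Measure_isProbability.Build _ _ _ unif01 unif01_setT.

End UniformMeasure.

(** * The random path driven by a uniform number *)

Section PathMeasure.
Context (R : realType) (S : choiceType) (step : S -> set (distr R S)) (s : S).
Context (sigma : seq S -> option (distr R S)) (sigmaP : is_scheduler step sigma).
Implicit Types (d : distr R S) (u : R) (w h : seq S).

Definition cdf d : S -> R := projT1 (cid (distr_intervals d)).

(** The default is a point of the support, so that [quantile_gt0] holds for every real [u] and
    [walk] yields a path without any hypothesis on [u]. *)
Definition quantile d u : S := xget (xget s [set y | 0 < d y])
  [set y | 0 < d y /\ cdf d y <= u < cdf d y + d y].

Lemma quantile_gt0 d u : 0 < d (quantile d u).
Proof.
rewrite /quantile; case: xgetP => [y _ []//|_].
by case: xgetP => // H; have [y /H] := distr_supp d.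
Qed.

Lemma quantileP d u y : 0 <= u < 1 -> 0 < d y ->
  quantile d u = y <-> cdf d y <= u < cdf d y + d y.
Proof.
rewrite /quantile /cdf; case: (cid _) => F [_ Fex Finj] /= u01 dy.
case: xgetP => [z _ [dz uz]|H]; last by have [z /H] := Fex u u01.
by split=> [<-//|uy]; exact: Finj uz uy.
Qed.

(* After the history [h], with current state [x], the number [u] in [0, 1[
   selects the next state, and its relative position in the interval of that
   state drives the rest of the path. *)
Fixpoint walk n h x u : option S :=
  if n is n'.+1 then
    if sigma (rcons h x) is Some d then
      walk n' (rcons h x) (quantile d u)
        ((u - cdf d (quantile d u)) / d (quantile d u))
    else None
  else Some x.

Lemma walk_mpath h x u : is_mpath step (fun n => walk n h x u).
Proof.
split=> // n; elim: n h x u => [|n IH] h x u /=.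
  have := sigmaP h x; case: (sigma _) => [d xd|x0 y [d]].
    by exists d => //; exact: quantile_gt0.
  by rewrite x0.
by case: (sigma _) => // d; exact: IH.
Qed.

Definition walk_path u : mpath step := MPath (walk_mpath [::] s u).

(** [cylinder_prob] unrolled from its first transition and after an arbitrary past [h], the form
    suited to induction along [walk]. *)
Fixpoint walk_prob h x w : R :=
  if w is y :: w' then
    (if sigma (rcons h x) is Some d then d y else 0) * walk_prob (rcons h x) y w'
  else 1.

Lemma walk_probE h x w x0 : walk_prob h x w =
  \prod_(i < size w) (if sigma (h ++ take i.+1 (x :: w)) is Some d
                      then d (nth x0 w i) else 0).
Proof.
elim: w h x => [|y w IH] h x; first by rewrite big_ord0.
rewrite big_ord_recl /= IH ?take0 cats1; congr (_ * _).
by apply: eq_bigr => i _; rewrite /= cat_rcons.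
Qed.

Lemma walk_prob_cylinder w : cylinder_prob s sigma s w = walk_prob [::] s w.
Proof. by rewrite /cylinder_prob eqxx (walk_probE _ _ _ s). Qed.

(** Rescaling maps the interval of the first successor [y] affinely onto [0, 1[, so the interval of
    the remaining word pulls back to one whose length is multiplied by [d y]. *)
Lemma walk_interval w h x : exists a b,
  [/\ 0 <= a, a <= b, b <= 1, b - a = walk_prob h x w &
    forall u, 0 <= u < 1 ->
      (forall i, (i < size w)%N -> walk i.+1 h x u = onth w i) <-> a <= u < b].
Proof.
elim: w h x => [|y w IH] h x /=.
  by exists 0, 1; split=> //; rewrite subr0.
(* An impossible first step gets the empty interval from 0 to 0. *)
have none (P : R -> Prop) : (forall u, 0 <= u < 1 -> ~ P u) ->
    exists a b, [/\ 0 <= a, a <= b, b <= 1,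
      b - a = 0 :> R & forall u, 0 <= u < 1 -> P u <-> a <= u < b].
  move=> H; exists 0, 0; split=> //; first by rewrite subrr.
  move=> u u01; split=> [/(H u u01)//|/andP[u0]].
  by rewrite ltNge u0.
case sx: (sigma (rcons h x)) => [d|]; last first.
  rewrite mul0r; apply: none => u u01 /(_ 0%N (ltn0Sn _)).
  by rewrite /= ?sx.
have [dy|dy] := ltP 0 (d y); last first.
  have -> : d y = 0 by apply/eqP; rewrite eq_le dy distr_ge0.
  rewrite mul0r; apply: none => u u01 /(_ 0%N (ltn0Sn _)).
  rewrite /= ?sx => -[qy]; have := quantile_gt0 d u.
  by rewrite qy ltNge dy.
have [a [b [a0 ab b1 <- abP]]] := IH (rcons h x) y.
have [F0 F1] : 0 <= cdf d y /\ cdf d y + d y <= 1.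
  by rewrite /cdf; case: (cid _) => F [H _ _] /=; exact: H.
exists (cdf d y + d y * a), (cdf d y + d y * b); split.
- by rewrite addr_ge0// mulr_ge0// ltW.
- by rewrite lerD2l ler_pM2l.
- by apply: le_trans F1; rewrite lerD2l ger_pMr.
- by rewrite mulrBr; lra.
move=> u u01.
have E1 : (0 <= (u - cdf d y) / d y < 1) = (cdf d y <= u < cdf d y + d y).
  by rewrite ler_pdivlMr// ltr_pdivrMr// mul0r mul1r subr_ge0 ltrBlDl.
have E2 : (a <= (u - cdf d y) / d y < b) =
    (cdf d y + d y * a <= u < cdf d y + d y * b).
  by rewrite ler_pdivlMr// ltr_pdivrMr// lerBrDl ltrBlDl ![d y * _]mulrC.
split=> [H|uab].
  have qy : quantile d u = y.
    by have := H 0%N (ltn0Sn _); rewrite /= ?sx => -[].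
  rewrite -E2; apply/abP; first by rewrite E1; apply/quantileP.
  by move=> i iw; have := H i.+1 iw; rewrite /= ?sx qy.
have uy : cdf d y <= u < cdf d y + d y.
  have /andP[ua ub] := uab; apply/andP; split.
    by apply: le_trans ua; rewrite lerDl mulr_ge0// ltW.
  by apply: lt_le_trans ub _; rewrite lerD2l ger_pMr.
have qy : quantile d u = y by apply/quantileP.
move=> [_|i]; first by rewrite /= ?sx qy.
rewrite ltnS => iw /=; rewrite ?sx qy.
have := abP ((u - cdf d y) / d y); rewrite E1 => /(_ uy)[_].
by apply=> //; rewrite E2.
Qed.

Lemma walk_cylinder x w : exists a b,
  [/\ 0 <= a, a <= b, b <= 1, b - a = cylinder_prob s sigma x w &
    forall u, 0 <= u < 1 -> cylinder (x :: w) (walk_path u) <-> a <= u < b].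
Proof.
have [->|xs] := eqVneq x s; last first.
  rewrite /cylinder_prob (negbTE xs); exists 0, 0; split=> //.
    by rewrite subrr.
  move=> u u01; split=> [/(_ 0%N (ltn0Sn _)) [sx]|/andP[u0]].
    by rewrite sx eqxx in xs.
  by rewrite ltNge u0.
have [a [b [a0 ab b1 abE abP]]] := walk_interval w [::] s.
exists a, b; split=> //; first by rewrite walk_prob_cylinder.
move=> u u01; rewrite -abP//; split=> [H i iw|H [|i] iw//]; last exact: H.
exact: (H i.+1).
Qed.

(** Outside [0, 1[, where [walk_cylinder] says nothing, the walk of 0 is substituted; [unif01] gives
    that set measure 0. *)
Definition walk_rv (u : measurableTypeR R) : borel_mpath step s :=
  walk_path (if 0 <= u < 1 then u else 0).

(** An open set may be an uncountable union of cylinders, but the walks from [0, 1[ meet only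
    countably many cylinders: the interval of such a cylinder is nonempty, hence contains a
    rational, and this rational together with the length determines the word. *)
Lemma walk_rv_measurable : measurable_fun setT walk_rv.
Proof.
apply: (@measurability _ _ _ _ setT walk_rv (@open (mpath_at step s))) => //.
move=> _ [V oV <-]; rewrite setTI.
pose I := [set u : R | 0 <= u < 1].
have mI : measurable (I : set (measurableTypeR R)).
  rewrite (_ : I = `[0, 1[%classic); first exact: measurable_itv.
  by apply/seteqP; split=> u; rewrite /I /= in_itv.
rewrite -(setIT (walk_rv @^-1` V)) -(setUv I) setIUr; apply: measurableU; last first.
  have [V0|V0] := pselect (V (walk_path 0)).
    rewrite (_ : _ `&` _ = ~` I); first exact: measurableC.
    apply/seteqP; split=> [u [_]//|u nI]; split=> //.
    by rewrite /preimage/= /walk_rv; case: ifPn.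
  rewrite (_ : _ `&` _ = set0)//; apply/seteqP; split=> // u [+ nI].
  by rewrite /preimage/= /walk_rv; case: ifPn.
have IE u : I u -> walk_rv u = walk_path u by rewrite /I /walk_rv /= => ->.
(* For [nq] = (n, q), [w] is the word of length n that the walk from q follows after [s], with its
   cylinder inside [V]. At most one [w] qualifies. *)
pose G (nq : nat * rat) (w : seq S) := [/\ size w = nq.1,
  cylinder (s :: w) `<=` (V : set (mpath step)), I (ratr nq.2) &
  cylinder (s :: w) (walk_path (ratr nq.2))].
pose J nq := [set u | I u /\ exists2 w, G nq w & cylinder (s :: w) (walk_path u)].
have -> : walk_rv @^-1` V `&` I = \bigcup_nq J nq.
  apply/seteqP; split=> [u [Vu Iu]|u [nq _ [Iu [w [_ wV _ _] wu]]]]; last first.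
    by split=> //; rewrite /preimage /= IE//; exact: wV.
  move: Vu; rewrite /preimage /= IE// => Vu.
  have [w wu wV] : exists2 w, cylinder (s :: w) (walk_path u) &
      cylinder (s :: w) `<=` (V : set (mpath step)).
    have [[|x w] wu wV] := (open_mpathP V).1 oV _ Vu.
      by exists [::]; [case|move=> p _; exact: wV].
    by have [sx] : Some s = Some x := wu 0%N isT; exists w; rewrite sx.
  have [a [b [a0 ab b1 _ abP]]] := walk_cylinder s w.
  have /andP[ua ub] := (abP u Iu).1 wu.
  have [q] := rat_in_itvoo (le_lt_trans ua ub); rewrite in_itv/= => /andP[aq qb].
  have Iq : I (ratr q).
    by rewrite /I /= (le_trans a0 (ltW aq)) (lt_le_trans qb b1).
  exists (size w, q) => //; split=> //; exists w => //; split=> //.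
  by apply/abP => //; rewrite (ltW aq).
apply: countable_bigcupT_measurable => // nq.
have [[w Gw]|nG] := pselect (exists w, G nq w); last first.
  rewrite (_ : J nq = set0)//; apply/seteqP; split=> // u [_ [w Gw _]].
  by apply: nG; exists w.
have [a [b [a0 ab b1 _ abP]]] := walk_cylinder s w.
rewrite (_ : J nq = `[a, b[%classic); first exact: measurable_itv.
apply/seteqP; split=> u /=; rewrite in_itv/=.
  move=> [Iu [w' Gw' w'u]]; rewrite -abP//.
  suff -> : w = w' by [].
  have [sw _ _ wq] := Gw; have [sw' _ _ wq'] := Gw'.
  apply: eq_from_onth => i; have [iw|wi] := ltnP i (size w).
    have iw' : (i < size w')%N by rewrite sw' -sw.
    exact: etrans (esym (wq i.+1 iw)) (wq' i.+1 iw').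
  by rewrite !onth_default// sw' -sw.
move=> uab; have Iu : I u.
  have /andP[ua ub] := uab.
  by rewrite /I /= (le_trans a0 ua) (lt_le_trans ub b1).
by split=> //; exists w => //; apply/abP.
Qed.

HB.instance Definition _ :=
  isMeasurableFun.Build _ _ _ _ walk_rv walk_rv_measurable.

Lemma walk_rv_cylinder x w :
  distribution (@unif01 R) walk_rv (cylinder (x :: w)) =
  (cylinder_prob s sigma x w)%:E.
Proof.
have [a [b [a0 ab b1 <- abP]]] := walk_cylinder x w.
rewrite /distribution /pushforward /= /unif01 /mrestr.
rewrite (_ : _ `&` _ = `[a, b[%classic).
  rewrite lebesgue_measure_itv/= lte_fin; case: ltP => // ba.
  by rewrite (_ : a = b) ?subrr//; apply/eqP; rewrite eq_le ab.
apply/seteqP; split=> u /=; rewrite !in_itv/= /walk_rv.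
  by move=> [+ u01]; rewrite u01 => /(abP _ u01).
move=> uab; have u01 : 0 <= u < 1.
  by have /andP[ua ub] := uab; rewrite (le_trans a0 ua) (lt_le_trans ub b1).
by split=> //; rewrite /preimage/= u01; exact/abP.
Qed.

(** [walk_rv] supplies a measure, so [xget] does not fall back on its default; the measure that it
    returns is known through its values on cylinders. *)
Lemma path_measureP : exists2 mu : probability (borel_mpath step s) R,
  path_measure s sigma = (mu : set (mpath step) -> \bar R) &
  forall x h, mu (cylinder (x :: h)) = (cylinder_prob s sigma x h)%:E.
Proof.
rewrite /path_measure; case: xgetP => [m _ [mu -> muP]|H].
  by exists mu.
exfalso; apply: H; exists (distribution (@unif01 R) walk_rv) => // x h.
exact: walk_rv_cylinder.
Qed.

End PathMeasure.

(** * Hitting probabilities *)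

Section Hitting.
Context (R : realType) (S : choiceType) (B1 B2 : set S).
Implicit Types (sigma : seq S -> option (distr R S)) (h : seq S).

(* The probability, after the history [rcons h x], that the until property
   holds from [x] on with at most [n] further steps. *)
Fixpoint hit sigma n h x : R :=
  if x \in B2 then 1
  else if x \in B1 then
    if n is n'.+1 then
      if sigma (rcons h x) is Some d then expect d (hit sigma n' (rcons h x)) else 0
    else 0
  else 0.

Definition hitlim sigma h x : R := sup (range (fun n => hit sigma n h x)).

Lemma unit_hit sigma n h : unit_valued (hit sigma n h).
Proof.
elim: n h => [|n IH] h x /=; do 2?[case: ifP => _; rewrite ?ler01 ?lexx//].
case: (sigma _) => [d|]; last by rewrite ler01 lexx.
by rewrite expect_ge0// expect_le1.
Qed.

Lemma hitSE sigma n h x : hit sigma n.+1 h x =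
  if x \in B2 then 1 else if x \in B1 then
    if sigma (rcons h x) is Some d then expect d (hit sigma n (rcons h x)) else 0
  else 0.
Proof. by []. Qed.

Lemma hitS sigma n h x : hit sigma n h x <= hit sigma n.+1 h x.
Proof.
elim: n h x => [|n IH] h x.
  have /andP[+ _] := unit_hit sigma 1 h x; rewrite hitSE /=.
  by do 2?[case: ifP => // _].
rewrite !hitSE; do 2?[case: ifP => // _]; case: (sigma _) => // d.
by apply: expect_le => // y; exact: unit_hit.
Qed.

Lemma hit_le_hitlim sigma n h x : hit sigma n h x <= hitlim sigma h x.
Proof.
apply: ub_le_sup; last by exists n.
by exists 1 => _ [m _ <-]; case/andP: (unit_hit sigma m h x).
Qed.

Lemma hitlim_le sigma h x (c : R) : (forall n, hit sigma n h x <= c) ->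
  hitlim sigma h x <= c.
Proof.
move=> H; apply: ge_sup; first by exists (hit sigma 0 h x), 0%N.
by move=> _ [n _ <-].
Qed.

Lemma unit_hitlim sigma h : unit_valued (hitlim sigma h).
Proof.
move=> x; apply/andP; split.
  by apply: le_trans (hit_le_hitlim sigma 0 h x); case/andP: (unit_hit sigma 0 h x).
by apply: hitlim_le => n; case/andP: (unit_hit sigma n h x).
Qed.

Lemma hit_cvg sigma h x : (fun n => hit sigma n h x) @ \oo --> hitlim sigma h x.
Proof.
apply: nondecreasing_cvgn; first by apply/nondecreasing_seqP => n; exact: hitS.
by exists 1 => _ [m _ <-]; case/andP: (unit_hit sigma m h x).
Qed.

(** [hit] consults [sigma] only on extensions of the current history, so the past can be replaced
    along with the scheduler. This is how schedulers are shifted by a first step. *)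
Lemma eq_hit sigma sigma' n h h' x :
  (forall t, sigma (h ++ x :: t) = sigma' (h' ++ x :: t)) ->
  hit sigma n h x = hit sigma' n h' x.
Proof.
elim: n h h' x => [//|n IH] h h' x H /=.
have := H [::]; rewrite !cats1 => ->.
do 2?[case: ifP => // _]; case: (sigma' _) => // d; congr expect.
by apply/funext => y; apply: IH => t; rewrite !cat_rcons.
Qed.

Lemma eq_hitlim sigma sigma' h h' x :
  (forall t, sigma (h ++ x :: t) = sigma' (h' ++ x :: t)) ->
  hitlim sigma h x = hitlim sigma' h' x.
Proof.
move=> H; rewrite /hitlim (_ : (fun n => hit sigma n h x) = fun n => hit sigma' n h' x)//.
by apply/funext => n; exact: eq_hit.
Qed.

Lemma hitlim1 sigma h x : B2 x -> hitlim sigma h x = 1.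
Proof.
move=> x2; apply/eqP; rewrite eq_le; have /andP[_ ->] := unit_hitlim sigma h x.
by apply: le_trans (hit_le_hitlim sigma 0 h x); rewrite /= mem_set.
Qed.

(** Monotone convergence: the expectation of [hit] with [n] steps after [x] is [hit] with [n.+1]
    steps at [x]. *)
Lemma expect_hitlim sigma h x d : sigma (rcons h x) = Some d -> B1 x -> ~ B2 x ->
  expect d (hitlim sigma (rcons h x)) <= hitlim sigma h x.
Proof.
move=> sd x1 x2; apply: (@expect_lim _ _ _ _ (fun n => hit sigma n (rcons h x))).
- exact: unit_hitlim.
- by move=> n; exact: unit_hit.
- by move=> y n; exact: hitS.
- move=> y e e0; have hs : has_sup (range (fun n => hit sigma n (rcons h x) y)).
    split; first by exists (hit sigma 0 (rcons h x) y), 0%N.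
    by exists 1 => _ [m _ <-]; case/andP: (unit_hit sigma m (rcons h x) y).
  have [_ [n _ <-] lt] := sup_adherent e0 hs.
  by exists n; rewrite -lerBlDr ltW.
- move=> n; apply: le_trans (hit_le_hitlim sigma n.+1 h x).
  by rewrite /= (memNset x2) (mem_set x1) sd.
Qed.

End Hitting.

(** * Probabilities of path events under a fixed scheduler *)

Section PathMeasureComputation.
Context (R : realType) (S : choiceType) (step : S -> set (distr R S)) (s : S).
Context (sigma : seq S -> option (distr R S)) (sigmaP : is_scheduler step sigma).
Context (mu : probability (borel_mpath step s) R).
Hypothesis muP : forall x h, mu (cylinder (x :: h)) = (cylinder_prob s sigma x h)%:E.
Implicit Types (d : distr R S) (h w : seq S) (B : set (borel_mpath step s)).

Local Notation cyl w := (cylinder w : set (borel_mpath step s)).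

Lemma cylinder_prob_rcons x h d y : sigma (x :: h) = Some d ->
  cylinder_prob s sigma x (rcons h y) = cylinder_prob s sigma x h * d y.
Proof.
move=> sd; rewrite /cylinder_prob; case: eqP => _; last by rewrite mul0r.
rewrite size_rcons big_ord_recr /= -cats1 takel_cat// take_size sd.
rewrite nth_cat ltnn subnn/=; congr (_ * _); apply: eq_bigr => i _.
by rewrite takel_cat ?nth_cat ?ltn_ord// ltnW.
Qed.

Lemma measurable_cylinder w : measurable (cyl w).
Proof. by apply: measurable_open_mpath; apply/open_mpathP => p wp; exists w. Qed.

Lemma cylinder_trivIset w : trivIset setT (fun y => cyl (rcons w y)).
Proof.
apply/trivIsetP => y z _ _ yz; apply/seteqP; split=> // p [].
move=> /cylinder_rcons[_ py] /cylinder_rcons[_]; rewrite py => -[] /eqP.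
by rewrite (negbTE yz).
Qed.

Lemma mu_cylinder_rcons w d y : w != [::] -> sigma w = Some d ->
  mu (cyl (rcons w y)) = (mu (cyl w) * (d y)%:E)%E.
Proof. by case: w => // x h _ sd; rewrite rcons_cons !muP (cylinder_prob_rcons _ sd). Qed.

(** The sum over [S] is a supremum of finite sums, each of which is the measure of a finite disjoint
    union inside the cylinder of [w]. *)
Lemma esum_cylinder_le w B : measurable B ->
  (\esum_(y in [set: S]) mu (cyl (rcons w y) `&` B) <= mu (cyl w `&` B))%E.
Proof.
move=> mB; apply: ge_ereal_sup => _ [X [finX _] <-].
rewrite -measure_fin_bigcup//.
- apply: le_measure; rewrite ?inE.
  + apply: fin_bigcup_measurable => // y _.
    by apply: measurableI => //; exact: measurable_cylinder.
  + by apply: measurableI => //; exact: measurable_cylinder.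
  + by move=> p [y _ [/cylinder_rcons[wp _] Bp]].
- apply/trivIsetP => y z _ _ yz.
  have /trivIsetP /(_ y z I I yz) := @cylinder_trivIset w.
  by rewrite setIACA => ->; rewrite set0I.
- move=> y _; apply: measurableI => //; exact: measurable_cylinder.
Qed.

(* The masses of the one-step extensions of [w] add up to that of [w], so both
   inequalities of [esum_cylinder_le], for [B] and for its complement, are
   equalities, whether or not there are countably many extensions. *)
Lemma mu_cylinder_split w d B : w != [::] -> sigma w = Some d -> measurable B ->
  mu (cyl w `&` B) = \esum_(y in [set: S]) mu (cyl (rcons w y) `&` B).
Proof.
move=> w0 sd mB; have mC := measurableC mB; have mw := measurable_cylinder.
have addC w' : mu (cyl w') = (mu (cyl w' `&` B) + mu (cyl w' `&` ~` B))%E.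
  by rewrite (measureDI mu (mw w') mB) addeC setDE.
have fin (D : set (borel_mpath step s)) : measurable D -> mu D \is a fin_num.
  by move=> mD; rewrite fin_num_measure.
have tot : (\esum_(y in [set: S]) mu (cyl (rcons w y) `&` B) +
    \esum_(y in [set: S]) mu (cyl (rcons w y) `&` ~` B))%E = mu (cyl w).
  rewrite -esumD => [|y _|y _]; [|exact: measure_ge0|exact: measure_ge0].
  rewrite (eq_esum (b := fun y => ((fine (mu (cyl w)))%:E * (d y)%:E)%E)); last first.
    by move=> y _; rewrite -addC fineK ?fin// (mu_cylinder_rcons _ w0 sd).
  rewrite esumZl ?fine_ge0//; last by move=> y; rewrite lee_fin distr_ge0.
  by rewrite distr_sum1 mule1 fineK ?fin.
have le1 := esum_cylinder_le w mB; have le2 := esum_cylinder_le w mC.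
apply/eqP; rewrite eq_le le1 andbT; move: tot; rewrite addC.
have f1 : mu (cyl w `&` B) \is a fin_num by apply: fin; exact: measurableI.
have f2 : mu (cyl w `&` ~` B) \is a fin_num by apply: fin; exact: measurableI.
have := esum_ge0 (fun y (_ : [set: S] y) => measure_ge0 mu (cyl (rcons w y) `&` B)).
have := esum_ge0 (fun y (_ : [set: S] y) => measure_ge0 mu (cyl (rcons w y) `&` ~` B)).
move: le1 le2 f1 f2.
move: (esum _ _) (esum _ _) (mu (_ `&` B)) (mu (_ `&` ~` B)).
move=> [a||] [b||] [c||] [e||] //=.
rewrite !lee_fin => ac be _ _ _ _ [E].
lra.
Qed.

Lemma mpath_stuck w x (p : mpath step) : sigma (rcons w x) = None ->
  cylinder (rcons w x) p -> p (size w).+1 = None.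
Proof.
move=> sx /cylinder_rcons[_ px]; case py: (p (size w).+1) => [y|//].
have [d xd _] := mpath_leads px py; have := sigmaP w x.
by rewrite sx => x0; rewrite x0 in xd.
Qed.

(** The cylinder of [s] has measure 1, an empty product, so its complement is null. *)
Lemma mu_start B : measurable B -> mu B = mu (cyl [:: s] `&` B).
Proof.
move=> mB; have mw := measurable_cylinder [:: s].
rewrite (measureDI mu mB mw) setIC -[RHS]add0e; congr (_ + _)%E.
apply/eqP; rewrite eq_le measure_ge0 andbT.
have <- : mu (~` cyl [:: s]) = 0%E.
  rewrite probability_setC// muP /cylinder_prob eqxx big_ord0.
  by rewrite -EFinB subrr.
apply: le_measure; rewrite ?inE.
- exact: measurableD.
- exact: measurableC.
- by move=> p [].
Qed.

Lemma measurable_next (B : set S) :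
  measurable (next_set B : set (borel_mpath step s)).
Proof.
by apply: (@measurable_prefix _ _ _ _ _ 1%N) => p q qp [y py By]; exists y; rewrite ?qp.
Qed.

Lemma mu_next (B : set S) : mu (next_set B : set (mpath step)) =
  (if sigma [:: s] is Some d then expect d \1_B else 0)%:E.
Proof.
rewrite mu_start; last exact: measurable_next.
case sd: (sigma [:: s]) => [d|]; last first.
  rewrite (_ : _ `&` _ = set0) ?measure0//; apply/seteqP; split=> // p [sp [y py _]].
  by have := @mpath_stuck [::] s p sd sp; rewrite /= py.
rewrite (mu_cylinder_split _ sd)//; last exact: measurable_next.
rewrite expectE; last exact: unit_indic.
apply: eq_esum => y _; rewrite indicE.
have [By|nBy] := pselect (B y).
  rewrite (mem_set By) mulr1 (_ : _ `&` _ = cyl (rcons [:: s] y)).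
    rewrite (mu_cylinder_rcons _ _ sd)// muP /cylinder_prob eqxx big_ord0.
    by rewrite -EFinM mul1r.
  apply/seteqP; split=> [p []//|p sp]; split=> //.
  by exists y => //; have /cylinder_rcons[] := sp.
rewrite (memNset nBy) mulr0 (_ : _ `&` _ = set0) ?measure0//.
apply/seteqP; split=> // p [/cylinder_rcons[_ /= py] [z]].
by rewrite py => -[<-].
Qed.

Section Until.
Variables B1 B2 : set S.

(** The event that [hit] measures, located at position [k] so that an induction can lengthen the
    history instead of shifting the path. *)
Definition until_within k n : set (borel_mpath step s) :=
  [set p : mpath step | exists2 j, (j <= n)%N &
    (exists2 y, p (k + j)%N = Some y & B2 y) /\
    (forall i, (i < j)%N -> exists2 y, p (k + i)%N = Some y & B1 y)].

Lemma measurable_until_within k n : measurable (until_within k n).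
Proof.
apply: (@measurable_prefix _ _ _ _ _ (k + n)%N) => p q qp [j jn [[y py y2] H]].
exists j => //; split; first by exists y => //; rewrite qp// leq_add2l.
move=> i ij; have [z pz z1] := H i ij; exists z => //.
by rewrite qp// leq_add2l (leq_trans (ltnW ij)).
Qed.

(** A conditional probability, written as a product because the cylinder may be null. At a state in
    [B1] but not in [B2], the first remaining step is moved into the history and the cylinder is
    split over its value. *)
Lemma mu_hit n h x : mu (cyl (rcons h x) `&` until_within (size h) n) =
  (mu (cyl (rcons h x)) * (hit B1 B2 sigma n h x)%:E)%E.
Proof.
have empty (D : set (borel_mpath step s)) (c : \bar R) : (forall p, ~ D p) ->
    mu D = (c * 0%:E)%E.
  move=> D0; rewrite mule0 (_ : D = set0) ?measure0//.
  by apply/seteqP; split=> // p /D0.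
elim: n h x => [|n IH] h x /=; have [x2|x2] := pselect (B2 x).
- rewrite (mem_set x2) mule1; congr (mu _); apply/seteqP; split=> [p []//|p hp].
  split=> //; have /cylinder_rcons[_ px] := hp; exists 0%N => //.
  by split=> //; exists x; rewrite ?addn0.
- rewrite (memNset x2) if_same; apply: empty => p [/cylinder_rcons[_ px] [j]].
  by rewrite leqn0 => /eqP-> [[y]]; rewrite addn0 px => -[<-].
- rewrite (mem_set x2) mule1; congr (mu _); apply/seteqP; split=> [p []//|p hp].
  split=> //; have /cylinder_rcons[_ px] := hp; exists 0%N => //.
  by split=> //; exists x; rewrite ?addn0.
rewrite (memNset x2).
have [x1|x1] := pselect (B1 x); last first.
  rewrite (memNset x1); apply: empty => p [/cylinder_rcons[_ px] [[|j] _ [[y py y2] H]]].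
    by move: py; rewrite addn0 px => -[yx]; rewrite yx in x2.
  by have [z] := H 0%N (ltn0Sn _); rewrite addn0 px => -[<-].
rewrite (mem_set x1).
have -> : cyl (rcons h x) `&` until_within (size h) n.+1 =
    cyl (rcons h x) `&` until_within (size h).+1 n.
  apply/seteqP; split=> p [hp [j jn [[y py y2] H]]]; split=> //;
      have /cylinder_rcons[_ px] := hp.
    case: j jn py H => [_|j jn py H].
      by rewrite addn0 px => -[yx]; rewrite yx in x2.
    exists j => //; split; first by exists y; rewrite ?addSnnS.
    by move=> i ij; rewrite addSnnS; exact: H.
  exists j.+1 => //; split; first by exists y; rewrite -?addSnnS.
  move=> [_|i]; first by exists x; rewrite ?addn0.
  by rewrite ltnS -addSnnS; exact: H.
have w0 : rcons h x != [::] by case: h {IH}.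
case sd: (sigma (rcons h x)) => [d|]; last first.
  apply: empty => p [hp [j _ [[y py _] _]]].
  by rewrite (mpath_none (mpath_stuck sd hp)) ?leq_addr in py.
rewrite (mu_cylinder_split w0 sd); last exact: measurable_until_within.
have fm : mu (cyl (rcons h x)) \is a fin_num.
  by rewrite fin_num_measure//; exact: measurable_cylinder.
rewrite expectE; last exact: unit_hit.
rewrite -[X in (X * _)%E]fineK// -esumZl ?fine_ge0//; last first.
  move=> y; rewrite lee_fin mulr_ge0 ?distr_ge0//.
  by case/andP: (@unit_hit R S B1 B2 sigma n (rcons h x) y).
apply: eq_esum => y _; rewrite fineK// -(size_rcons h x) IH.
by rewrite (mu_cylinder_rcons _ w0 sd) -muleA EFinM.
Qed.

Lemma mu_until : mu (until_set B1 B2 : set (mpath step)) =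
  (hitlim B1 B2 sigma [::] s)%:E.
Proof.
have UE : (until_set B1 B2 : set (borel_mpath step s)) = \bigcup_n until_within 0 n.
  apply/seteqP; split=> p [n]; first by move=> H; exists n => //; exists n.
  by move=> _ [j _ [H H']]; exists j.
rewrite UE.
have mU := measurable_until_within 0.
have mun n : mu (until_within 0 n) = (hit B1 B2 sigma n [::] s)%:E.
  rewrite mu_start// (mu_hit n [::] s) muP /cylinder_prob eqxx big_ord0.
  by rewrite mul1e.
have nd : nondecreasing_seq (until_within 0).
  move=> n m nm; apply/subsetPset => p [j jn H]; exists j => //.
  exact: leq_trans nm.
have cv : (fun n => mu (until_within 0 n)) @ \oo --> mu (\bigcup_n until_within 0 n).
  exact: (nondecreasing_cvg_mu mU (bigcupT_measurable _ mU) nd).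
rewrite (_ : (fun n => mu (until_within 0 n)) =
    fun n => (hit B1 B2 sigma n [::] s)%:E) in cv; last exact/funext.
apply: (cvg_unique _ cv); first exact: ereal_hausdorff.
by apply: cvg_EFin; [exact: nearW|exact: hit_cvg].
Qed.

End Until.

End PathMeasureComputation.

(** * Optimal schedulers *)

Section Optimality.
Context (R : realType) (S : choiceType) (step : S -> set (distr R S)).
Implicit Types (sigma : seq S -> option (distr R S)) (d : distr R S).

Definition any_scheduler (w : seq S) : option (distr R S) :=
  if w is z :: t then
    if pselect (step (last z t) !=set0) is left e then Some (projT1 (cid e)) else None
  else None.

Lemma any_schedulerP : is_scheduler step any_scheduler.
Proof.
move=> h x; rewrite /any_scheduler.
have [z [t [-> lx]]] : exists z t, rcons h x = z :: t /\ last z t = x.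
  by case: h => [|z t]; [exists x, [::]|exists z, (rcons t x); rewrite last_rcons].
rewrite lx; case: pselect => [e|/set0P/negP/negPn/eqP//].
exact: projT2 (cid e).
Qed.

(** After the first step the initial state is dropped and [next y] starts afresh. A scheduler must
    also handle one-state histories other than [s]; [any_scheduler] fills them in. *)
Definition combine s d (next : S -> seq S -> option (distr R S)) (w : seq S) :=
  match w with
  | [::] => None
  | [:: z] => if z == s then Some d else any_scheduler [:: z]
  | z :: ((y :: _) as t) => next y t
  end.

Lemma combineP s d next : step s d -> (forall y, is_scheduler step (next y)) ->
  is_scheduler step (combine s d next).
Proof.
move=> sd nextP [|z h] x /=.
  by case: eqP => [->//|_]; exact: (any_schedulerP [::] x).
case E: (rcons h x) => [|y t]; first by case: h E.
by rewrite -E; exact: nextP.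
Qed.

Lemma scheduler_none sigma x : is_scheduler step sigma ->
  step x = set0 -> sigma [:: x] = None.
Proof.
move=> sP x0; have := sP [::] x; rewrite /=; case: (sigma _) => // d.
by rewrite x0.
Qed.

Lemma schedulers_nonempty (V : (seq S -> option (distr R S)) -> R) :
  [set V sigma | sigma in is_scheduler step] !=set0.
Proof. by exists (V any_scheduler), any_scheduler => //; exact: any_schedulerP. Qed.

Lemma sup_schedulers (V : (seq S -> option (distr R S)) -> R) (r : R) :
  (forall sigma, is_scheduler step sigma -> V sigma <= r) ->
  (forall e, 0 < e -> exists2 sigma, is_scheduler step sigma & r <= V sigma + e) ->
  sup [set V sigma | sigma in is_scheduler step] = r.
Proof.
move=> Vr Vadh; apply/eqP; rewrite eq_le; apply/andP; split.
  apply: ge_sup; first exact: schedulers_nonempty.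
  by move=> _ [sigma sP <-]; exact: Vr.
apply/ler_addgt0Pr => e e0; have [sigma sP /le_trans] := Vadh e e0; apply.
rewrite lerD2r; apply: ub_le_sup; last by exists sigma.
by exists r => _ [sigma' sP' <-]; exact: Vr.
Qed.

Lemma inf_schedulers (V : (seq S -> option (distr R S)) -> R) (r : R) :
  (forall sigma, is_scheduler step sigma -> r <= V sigma) ->
  (forall e, 0 < e -> exists2 sigma, is_scheduler step sigma & V sigma <= r + e) ->
  inf [set V sigma | sigma in is_scheduler step] = r.
Proof.
move=> Vr Vadh; apply/eqP; rewrite eq_le; apply/andP; split; last first.
  apply: lb_le_inf; first exact: schedulers_nonempty.
  by move=> _ [sigma sP <-]; exact: Vr.
apply/ler_addgt0Pr => e e0; have [sigma sP] := Vadh e e0; apply: le_trans.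
apply: ge_inf; last by exists sigma.
by exists r => _ [sigma' sP' <-]; exact: Vr.
Qed.

Definition next_value (B : set S) x sigma : R :=
  if sigma [:: x] is Some d then expect d \1_B else 0.

Lemma sup_next (B : set S) x :
  sup [set next_value B x sigma | sigma in is_scheduler step] =
  dia_sem step \1_B x.
Proof.
have Bu : unit_valued (\1_B : S -> R) by exact: unit_indic.
apply: sup_schedulers => [sigma sP|e e0].
  have := sP [::] x; rewrite /next_value /=.
  case: (sigma _) => [d|_]; first exact: dia_ge.
  by case/andP: (unit_dia step Bu x).
have [x0|/set0P/negP/negPn/eqP x0] := pselect (step x !=set0); last first.
  exists any_scheduler; first exact: any_schedulerP.
  rewrite /next_value (scheduler_none any_schedulerP x0) /dia_sem asboolF; last first.
    by rewrite x0 => -[].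
  by rewrite add0r ltW.
(* A transition near the supremum is one near the infimum for the complementary function. *)
have [d xd le] := box_adherent (unit_compl Bu) x0 e0.
exists (combine x d (fun=> any_scheduler)).
  by apply: combineP => // _; exact: any_schedulerP.
move: le; rewrite /next_value /= eqxx box_compl// expect_compl//; lra.
Qed.

(** At a dead state every scheduler has value 0, as there is no next state; hence [boxdot_sem] and
    not [box_sem], whose value there is 1. *)
Lemma inf_next (B : set S) x :
  inf [set next_value B x sigma | sigma in is_scheduler step] =
  boxdot_sem step \1_B x.
Proof.
have Bu : unit_valued (\1_B : S -> R) by exact: unit_indic.
apply: inf_schedulers => [sigma sP|e e0].
  rewrite boxdotE//; case: asboolP => [x0|x0]; last first.
    by rewrite /next_value; case: (sigma _) => // d; exact: expect_ge0.
  have := sP [::] x; rewrite /next_value /=.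
  case: (sigma _) => [d|x0']; first exact: box_le.
  by case: x0 => d; rewrite x0'.
rewrite boxdotE//; case: asboolP => [x0|/set0P/negP/negPn/eqP x0]; last first.
  exists any_scheduler; first exact: any_schedulerP.
  by rewrite /next_value (scheduler_none any_schedulerP x0) add0r ltW.
have [d xd le] := box_adherent Bu x0 e0.
exists (combine x d (fun=> any_scheduler)); last by rewrite /next_value /= eqxx.
by apply: combineP => // _; exact: any_schedulerP.
Qed.

Section Until.
Variables B1 B2 : set S.
Local Notation hlim := (hitlim B1 B2).

Let supV x := sup [set hlim sigma [::] x | sigma in is_scheduler step].
Let infV x := inf [set hlim sigma [::] x | sigma in is_scheduler step].

Let le_supV x sigma : is_scheduler step sigma -> hlim sigma [::] x <= supV x.
Proof.
move=> sP; apply: ub_le_sup; last by exists sigma.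
by exists 1 => _ [sigma' _ <-]; case/andP: (unit_hitlim B1 B2 sigma' [::] x).
Qed.

Let supV_le x (c : R) :
  (forall sigma, is_scheduler step sigma -> hlim sigma [::] x <= c) ->
  supV x <= c.
Proof.
move=> H; apply: ge_sup.
  exact: schedulers_nonempty.
by move=> _ [sigma sP <-]; exact: H.
Qed.

Let infV_le x sigma : is_scheduler step sigma -> infV x <= hlim sigma [::] x.
Proof.
move=> sP; apply: ge_inf; last by exists sigma.
by exists 0 => _ [sigma' _ <-]; case/andP: (unit_hitlim B1 B2 sigma' [::] x).
Qed.

Let le_infV x (c : R) :
  (forall sigma, is_scheduler step sigma -> c <= hlim sigma [::] x) ->
  c <= infV x.
Proof.
move=> H; apply: lb_le_inf.
  exact: schedulers_nonempty.
by move=> _ [sigma sP <-]; exact: H.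
Qed.

Let unit_supV : unit_valued supV.
Proof.
move=> x; have h := @unit_hitlim R S B1 B2; apply/andP; split.
  by apply: le_trans (le_supV x any_schedulerP); case/andP: (h any_scheduler [::] x).
by apply: supV_le => sigma _; case/andP: (h sigma [::] x).
Qed.

Let unit_infV : unit_valued infV.
Proof.
move=> x; have h := @unit_hitlim R S B1 B2; apply/andP; split.
  by apply: le_infV => sigma _; case/andP: (h sigma [::] x).
by apply: le_trans (infV_le x any_schedulerP) _; case/andP: (h any_scheduler [::] x).
Qed.

Lemma sup_until x :
  sup [set hlim sigma [::] x | sigma in is_scheduler step] =
  lfp (until_op B1 B2 (dia_sem step)) x.
Proof.
suff -> : lfp (until_op B1 B2 (dia_sem step)) = supV by [].
apply: until_lfp => //.
- by move=> h; exact: unit_dia.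
- by move=> g h; exact: dia_mono.
- move=> y y2; apply/eqP; rewrite eq_le; have /andP[_ ->] := unit_supV y.
  by apply: le_trans (le_supV y any_schedulerP); rewrite hitlim1.
- move=> y y1 y2; apply: dia_le; first by case/andP: (unit_supV y).
  move=> d yd; apply/ler_addgt0Pr => e e0.
  (* The supremum need not be attained, so an e-optimal scheduler is chosen for each successor; the
     common error [e] passes through the expectation unchanged. *)
  have /choice[next nextP] : forall z, exists sigma,
      is_scheduler step sigma /\ supV z <= hlim sigma [::] z + e.
    move=> z; have hs : has_sup [set hlim sigma [::] z | sigma in is_scheduler step].
      split; first exact: schedulers_nonempty.
      by exists 1 => _ [sigma' _ <-]; case/andP: (unit_hitlim B1 B2 sigma' [::] z).
    by have [_ [sigma sP <-] /ltW] := sup_adherent e0 hs; rewrite lerBlDr; exists sigma.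
  have cP : is_scheduler step (combine y d next).
    by apply: combineP => // z; have [] := nextP z.
  have cy : combine y d next (rcons [::] y) = Some d by rewrite /= eqxx.
  apply: (@le_trans _ _ (expect d (hlim (combine y d next) [:: y]) + e)).
    apply: expect_le_add => //; [exact: unit_hitlim|exact: ltW|move=> z].
    (* Past its first step, [combine] acts as [next z] with an empty history. *)
    by rewrite (@eq_hitlim _ _ _ _ _ (next z) _ [::])//; have [] := nextP z.
  rewrite lerD2r; apply: le_trans (le_supV y cP).
  exact: (expect_hitlim cy).
- move=> g gu g2 g1 y; apply: supV_le => sigma sP; apply: hitlim_le => n.
  (* Generalised over the history, on which the scheduler may depend. *)
  elim: n [::] y => [|n IH] h y /=; have /andP[g0 _] := gu y.
    have [y2|y2] := pselect (B2 y); first by rewrite (mem_set y2) g2.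
    by rewrite (memNset y2) if_same.
  have [y2|y2] := pselect (B2 y); first by rewrite (mem_set y2) g2.
  rewrite (memNset y2); have [y1|y1] := pselect (B1 y); last by rewrite (memNset y1).
  rewrite (mem_set y1); have := sP h y; case: (sigma _) => // d yd.
  apply: le_trans (g1 _ y1); apply: le_trans (dia_ge gu yd).
  by apply: expect_le => //; exact: unit_hit.
Qed.

Lemma inf_until x :
  inf [set hlim sigma [::] x | sigma in is_scheduler step] =
  lfp (until_op B1 B2 (boxdot_sem step)) x.
Proof.
suff -> : lfp (until_op B1 B2 (boxdot_sem step)) = infV by [].
apply: until_lfp => //.
- by move=> h; exact: unit_boxdot.
- by move=> g h; exact: boxdot_mono.
- move=> y y2; apply/eqP; rewrite eq_le; have /andP[_ ->] := unit_infV y.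
  by apply: le_infV => sigma _; rewrite hitlim1.
- move=> y y1 y2; apply: le_infV => sigma sP; rewrite boxdotE//.
  case: asboolP => [y0|_]; last by case/andP: (unit_hitlim B1 B2 sigma [::] y).
  have := sP [::] y; rewrite /=; case sy: (sigma _) => [d|]; last first.
    by case: y0 => d + y0'; rewrite y0'.
  move=> yd; apply: (le_trans (box_le unit_infV yd)).
  apply: le_trans (expect_hitlim (h := [::]) sy y1 y2).
  apply: expect_le => //; first exact: unit_hitlim.
  (* The scheduler shifted by the first state [y] is among those over which [infV z] is taken. *)
  move=> z; rewrite (@eq_hitlim _ _ _ _ _ (fun w => sigma (y :: w)) _ [::])//.
  by apply: infV_le => h w; exact: (sP (y :: h) w).
- move=> g gu g2 g1 y; apply/ler_addgt0Pr => e e0.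
  (* The tolerances from step [n] on add up to twice [eps n], that is e / 2^n, which is [e] at the
     start. *)
  pose eps n : R := e / 2 ^+ n.+1.
  have eps0 n : 0 < eps n by rewrite divr_gt0// exprn_gt0.
  have epsS n : eps n.+1 + eps n.+1 = eps n.
    by rewrite /eps [in LHS]exprS; field; rewrite expf_neq0.
  have /choice[c cP] : forall z, exists f : nat -> option (distr R S), forall n,
      if f n is Some d then step z d /\ expect d g <= box_sem step g z + eps n
      else step z = set0.
    move=> z; have [z0|/set0P/negP/negPn/eqP z0] := pselect (step z !=set0); last first.
      by exists (fun=> None).
    have /choice[f fP] : forall n, exists d,
        step z d /\ expect d g <= box_sem step g z + eps n.
      by move=> n; have [d] := box_adherent gu z0 (eps0 n); exists d.
    by exists (fun n => Some (f n)).
  (* Besides the current state, the scheduler uses only the number of steps made, which selects the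
     tolerance. *)
  pose sigma w := if w is z :: t then c (last z t) (size t) else None.
  have sigmaE h z : sigma (rcons h z) = c z (size h).
    by case: h => [//|z' t] /=; rewrite last_rcons size_rcons.
  have sP : is_scheduler step sigma.
    move=> h z; rewrite sigmaE; have := cP z (size h).
    by case: (c _ _) => // d [].
  apply: (le_trans (infV_le y sP)); apply: hitlim_le => n.
  have H m h z : hit B1 B2 sigma m h z <= g z + (eps (size h) + eps (size h)).
    elim: m h z => [|m IH] h z /=; have /andP[g0 _] := gu z;
      have ge : 0 <= g z + (eps (size h) + eps (size h)) by rewrite !addr_ge0// ltW.
      have [z2|z2] := pselect (B2 z); last by rewrite (memNset z2) if_same.
      by rewrite (mem_set z2) g2// lerDl addr_ge0// ltW.
    have [z2|z2] := pselect (B2 z).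
      by rewrite (mem_set z2) g2// lerDl addr_ge0// ltW.
    rewrite (memNset z2); have [z1|z1] := pselect (B1 z); last by rewrite (memNset z1).
    rewrite (mem_set z1) sigmaE; have := cP z (size h); case: (c _ _) => // d [zd le].
    have zb : box_sem step g z <= g z.
      by apply: le_trans (g1 _ z1); rewrite boxdotE// asboolT//; exists d.
    rewrite addrA; apply: (@le_trans _ _ (expect d g + eps (size h))).
      apply: expect_le_add => //; [exact: unit_hit|exact: ltW|move=> w].
      by have := IH (rcons h z) w; rewrite size_rcons epsS.
    by rewrite lerD2r (le_trans le)// lerD2r.
  have := H n [::] y; rewrite /= (_ : eps 0%N + eps 0%N = e)//.
  by rewrite /eps expr1; field.
Qed.

End Until.

Lemma path_measure_sup (E : set (mpath step)) (V : (seq S -> option (distr R S)) -> R) s :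
  (forall sigma, is_scheduler step sigma -> path_measure s sigma E = (V sigma)%:E) ->
  (forall sigma, 0 <= V sigma <= 1) ->
  ereal_sup [set path_measure s sigma E | sigma in is_scheduler step] =
    (sup [set V sigma | sigma in is_scheduler step])%:E /\
  ereal_inf [set path_measure s sigma E | sigma in is_scheduler step] =
    (inf [set V sigma | sigma in is_scheduler step])%:E.
Proof.
move=> EV V01.
have -> : [set path_measure s sigma E | sigma in is_scheduler step] =
    [set x%:E | x in [set V sigma | sigma in is_scheduler step]].
  apply/seteqP; split=> [_ [sigma sP <-]|_ [_ [sigma sP <-] <-]].
    by exists (V sigma); [exists sigma|rewrite EV].
  by exists sigma => //; rewrite EV.
have V0 : [set V sigma | sigma in is_scheduler step] !=set0.
  exact: schedulers_nonempty.
split; [apply: ereal_sup_EFin|apply: ereal_inf_EFin] => //.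
  by exists 1 => _ [sigma _ <-]; case/andP: (V01 sigma).
by exists 0 => _ [sigma _ <-]; case/andP: (V01 sigma).
Qed.

Lemma path_measure_next (B : set S) s :
  ereal_sup [set path_measure s sigma (next_set B : set (mpath step))
            | sigma in is_scheduler step] = (dia_sem step \1_B s)%:E /\
  ereal_inf [set path_measure s sigma (next_set B : set (mpath step))
            | sigma in is_scheduler step] = (boxdot_sem step \1_B s)%:E.
Proof.
rewrite -sup_next -inf_next; apply: path_measure_sup => sigma; last first.
  rewrite /next_value; case: (sigma _) => [d|]; last by rewrite lexx ler01.
  by rewrite expect_ge0 ?expect_le1//; exact: unit_indic.
move=> sP; have [mu -> muP] := path_measureP s sP.
exact: mu_next.
Qed.

Lemma path_measure_until (B1 B2 : set S) s :
  ereal_sup [set path_measure s sigma (until_set B1 B2 : set (mpath step))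
            | sigma in is_scheduler step] =
    (lfp (until_op B1 B2 (dia_sem step)) s)%:E /\
  ereal_inf [set path_measure s sigma (until_set B1 B2 : set (mpath step))
            | sigma in is_scheduler step] =
    (lfp (until_op B1 B2 (boxdot_sem step)) s)%:E.
Proof.
rewrite -sup_until -inf_until; apply: path_measure_sup => sigma; last first.
  exact: unit_hitlim.
move=> sP; have [mu -> muP] := path_measureP s sP.
exact: mu_until.
Qed.

End Optimality.

(** * Correctness of the encoding *)

Section Encoding.
Context (R : realType) (S : choiceType) (step : S -> set (distr R S)).
Context (A : Type).
Implicit Types (f g : lmu A) (v : nat -> S -> R).

Lemma scal_const_prob_cmp c q f : scal_const f -> scal_const (prob_cmp c q f).
Proof. by case: c; rewrite /= ?/prob_gt ?/prob_ge => fs; do 2?[case: ifP => _]. Qed.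

Lemma scal_const_until nxt f g : (forall X, scal_const (nxt (Var X))) ->
  scal_const f -> scal_const g -> scal_const (until_f nxt f g).
Proof. by move=> nP fs gs; split=> //; split. Qed.

Variable rho : A -> S -> R.
Hypothesis rho_unit : forall P, unit_valued (rho P).

Lemma sem_boxdot v f :
  lmu_sem step rho v (boxdot f) = boxdot_sem step (lmu_sem step rho v f).
Proof.
transitivity (fun x => Num.min (box_sem step (lmu_sem step rho v f) x)
  (dia_sem step (lmu_sem step rho v (one_f A)) x)); first by [].
by rewrite sem_one.
Qed.

(** Closedness of [f1] and [f2] is expressed by fixing their values under every unit valued
    valuation; updating the bound variable then leaves them unchanged. *)
Lemma sem_until v (nxt : lmu A -> lmu A) f1 f2 (B1 B2 : set S) N :
  (forall X, unit_valued (v X)) ->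
  (forall w, (forall X, unit_valued (w X)) -> lmu_sem step rho w f1 = \1_B1) ->
  (forall w, (forall X, unit_valued (w X)) -> lmu_sem step rho w f2 = \1_B2) ->
  (forall w X, (forall Y, unit_valued (w Y)) ->
    lmu_sem step rho w (nxt (Var X)) = N (w X)) ->
  lmu_sem step rho v (until_f nxt f1 f2) = lfp (until_op B1 B2 N).
Proof.
move=> vu H1 H2 HN; apply: eq_lfp => h hu; set X := maxn _ _.
have wu := unit_upd X vu hu.
transitivity (fun x => Num.max (lmu_sem step rho [eta v with X |-> h] f2 x)
  (Num.min (lmu_sem step rho [eta v with X |-> h] f1 x)
    (lmu_sem step rho [eta v with X |-> h] (nxt (Var X)) x))); first by [].
by rewrite H1// H2// HN//= eqxx.
Qed.

End Encoding.

Scheme pctl_mut := Induction for pctl Sort Prop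
with pctl_path_mut := Induction for pctl_path Sort Prop.

Lemma comparesE (R : realType) c (a : R) q : compares c a%:E q = cmp_real c a q.
Proof. by case: c; rewrite /compares /cmp_real ?lte_fin ?lee_fin. Qed.

(** One induction proves both parts: negation needs [scal_const] of the subformula, and quantifying
    over valuations lets [sem_until] evaluate subformulas under a binder. *)
Lemma sem_encode (R : realType) (S : choiceType) (step : S -> set (distr R S))
    (A : Type) (rho : A -> set S) (phi : pctl A) :
  scal_const (encode phi) /\
  forall v, (forall X, unit_valued (v X)) ->
    lmu_sem step (fun P => \1_(rho P)) v (encode phi) = \1_(pctl_sem step rho phi).
Proof.
have rho_unit P : unit_valued (\1_(rho P) : S -> R) by exact: unit_indic.
pose Q (phi : pctl A) := scal_const (encode phi) /\
  forall v, (forall X, unit_valued (v X)) ->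
    lmu_sem step (fun P => \1_(rho P)) v (encode phi) = \1_(pctl_sem step rho phi).
(* A path formula has no encoding of its own; it only carries the hypotheses on its state
   subformulas. *)
pose Qpath (psi : pctl_path A) := match psi with
  Next phi => Q phi | Until phi1 phi2 => Q phi1 /\ Q phi2 end.
apply: (@pctl_mut A Q Qpath).
- split=> // v vu; rewrite [encode _]/= sem_one; apply/funext => x.
  by rewrite indicE mem_set.
- by [].
- move=> phi1 [sc IH]; split; first exact: scal_const_dual.
  (* Applied to the complemented valuation, whose complement is [v] again. *)
  move=> v vu; have := sem_dual step rho_unit (fun X => unit_compl (vu X)) sc.
  rewrite IH; last by move=> X; exact: unit_compl.
  rewrite (_ : (fun X x => 1 - (1 - v X x)) = v); last first.
    by apply/funext => X; apply/funext => x; rewrite subKr.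
  move=> ->; apply/funext => x; rewrite !indicE.
  have [H|H] := pselect (pctl_sem step rho phi1 x).
    by rewrite mem_set// memNset ?subrr//= => /(_ H).
  by rewrite memNset// mem_set// subr0.
- move=> phi1 [sc1 IH1] phi2 [sc2 IH2]; split=> // v vu.
  transitivity (fun x => Num.max
    (lmu_sem step (fun P => \1_(rho P)) v (encode phi1) x)
    (lmu_sem step (fun P => \1_(rho P)) v (encode phi2) x)); first by [].
  rewrite IH1// IH2//; apply/funext => x; rewrite !indicE /= in_setU.
  case: (x \in pctl_sem step rho phi1); case: (x \in pctl_sem step rho phi2);
    by rewrite /= ?maxxx// /Num.max ?ltr01 ?ltr10.
- case=> [phi1 [sc IH]|phi1 phi2 [[sc1 IH1] [sc2 IH2]]]; split=> // v vu.
  + rewrite [encode _]/= sem_prob_gt0//; congr (\1_ _); apply/seteqP.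
    have e : lmu_sem step (fun P => \1_(rho P)) v (Dia (encode phi1)) =
        dia_sem step \1_(pctl_sem step rho phi1) by rewrite -(IH v vu).
    split=> x; rewrite /mkset e.
      move=> /(dia_gt0P _ _ (@unit_indic _ _ _))[y xy].
      rewrite indicE; have [|_] := boolP (y \in _); last by rewrite ltxx.
      by rewrite inE => y1 _; apply/ex_next; exists y.
    move=> /ex_next[y xy y1]; apply/(dia_gt0P _ _ (@unit_indic _ _ _)).
    by exists y => //; rewrite indicE mem_set.
  + rewrite [encode _]/= (sem_until (B1 := pctl_sem step rho phi1)
      (B2 := pctl_sem step rho phi2)
      (N := fun h => \1_[set x | 0 < dia_sem step h x]))//.
      exact: ex_until.
    by move=> w X wu; rewrite sem_prob_gt0.
- case=> [phi1 [sc IH]|phi1 phi2 [[sc1 IH1] [sc2 IH2]]]; split=> // v vu.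
  + rewrite [encode _]/= sem_prob_eq1//; congr (\1_ _); apply/seteqP.
    rewrite sem_boxdot IH//.
    split=> x; rewrite /mkset.
      move=> /(boxdot_eq1P _ _ (@unit_indic _ _ _))[xs H]; apply/all_next.
      by split=> // y /H/eqP; rewrite indicE pnatr_eq1 eqb1 inE.
    move=> /all_next[xs H]; apply/(boxdot_eq1P _ _ (@unit_indic _ _ _)).
    by split=> // y /H y1; rewrite indicE mem_set.
  + rewrite [encode _]/= (sem_until (B1 := pctl_sem step rho phi1)
      (B2 := pctl_sem step rho phi2)
      (N := fun h => \1_[set x | boxdot_sem step h x = 1]))//.
      exact: all_until.
    by move=> w X wu; rewrite sem_prob_eq1// sem_boxdot.
- move=> c q [phi1 [sc IH]|phi1 phi2 [[sc1 IH1] [sc2 IH2]]].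
  + split; first exact: scal_const_prob_cmp.
    move=> v vu; rewrite [encode _]/= sem_prob_cmp//; congr (\1_ _).
    have e : lmu_sem step (fun P => \1_(rho P)) v (Dia (encode phi1)) =
        dia_sem step \1_(pctl_sem step rho phi1) by rewrite -(IH v vu).
    rewrite e; apply/funext => x /=.
    by rewrite (path_measure_next step _ x).1 comparesE.
  + split; first by apply: scal_const_prob_cmp; apply: scal_const_until.
    move=> v vu; rewrite [encode _]/= sem_prob_cmp//; congr (\1_ _).
    rewrite (sem_until (B1 := pctl_sem step rho phi1)
      (B2 := pctl_sem step rho phi2) (N := dia_sem step))//.
    apply/funext => x /=.
    by rewrite (path_measure_until step _ _ x).1 comparesE.
- move=> c q [phi1 [sc IH]|phi1 phi2 [[sc1 IH1] [sc2 IH2]]].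
  + split; first exact: scal_const_prob_cmp.
    move=> v vu; rewrite [encode _]/= sem_prob_cmp//; congr (\1_ _).
    rewrite sem_boxdot IH//; apply/funext => x /=.
    by rewrite (path_measure_next step _ x).2 comparesE.
  + split; first by apply: scal_const_prob_cmp; apply: scal_const_until.
    move=> v vu; rewrite [encode _]/= sem_prob_cmp//; congr (\1_ _).
    rewrite (sem_until (B1 := pctl_sem step rho phi1)
      (B2 := pctl_sem step rho phi2) (N := boxdot_sem step))//; last first.
      by move=> w X wu; rewrite sem_boxdot.
    apply/funext => x /=.
    by rewrite (path_measure_until step _ _ x).2 comparesE.
- by [].
- by [].
Qed.

Theorem theorem1 (R : realType) (S : choiceType) (step : S -> set (distr R S))
  (A : Type) (rho : A -> set S) (v : nat -> S -> R)
  (hv : forall X, unit_valued (v X)) (phi : pctl A) (s : S) :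
  \1_(pctl_sem step rho phi) s =
  lmu_sem step (fun P => \1_(rho P)) v (encode phi) s.
Proof. by have [_ ->] := sem_encode step rho phi. Qed.
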